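(* Let $R$ be a commutative ring that is essentially of finite type over a field, and let $I\subseteq R$ be an ideal. Then the symbolic analytic spread of $I$ satisfies $\mathrm{s}\ell(I)<\infty$; that is, there exists $t\in\mathbb{R}$ such that $\mu(I^{(n)})=O(n^{t-1})$ as $n\to\infty$, where $I^{(n)}$ denotes the $n$-th symbolic power of $I$.
   Context: A ring is essentially of finite type over a field $\Bbbk$ if it is a localization $W^{-1}R_0$ of a finitely generated commutative $\Bbbk$-algebra $R_0$ at a multiplicatively closed subset $W\subseteq R_0$. The ring $R$ is not assumed to be local. For an $R$-module $M$, $\mu(M)$ denotes the smallest cardinality of a generating set of $M$. For an ideal $I$ of a Noetherian ring $R$, the symbolic powers of $I$ are $$I^{(n)}=\bigcap_{\mathfrak p\in\operatorname{Min}(I)}\bigl(I^nR_{\mathfrak p}\cap R\bigr),$$ where $\operatorname{Min}(I)$ is the set of minimal primes of $I$ and $I^nR_{\mathfrak p}\cap R$ denotes the preimage of $I^nR_{\mathfrak p}$ under the localization map $R\to R_{\mathfrak p}$. The symbolic analytic spread of $I$ is $$\mathrm{s}\ell(I)=\inf\bigl\{t\in\mathbb{R}\mid \mu(I^{(n)})=O(n^{t-1})\bigr\},$$ with $\inf\varnothing=+\infty$. *)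

(* Defs.v *)
From HB Require Import structures.
From mathcomp Require Import all_boot all_order all_algebra.
From mathcomp Require Import finmap.
From mathcomp Require Import all_classical all_reals all_analysis.
From mathcomp Require Import ring.

Set Implicit Arguments.
Unset Strict Implicit.
Unset Printing Implicit Defensive.

Import Order.TTheory GRing.Theory Num.Theory.
Import numFieldNormedType.Exports.

Local Open Scope classical_set_scope.
Local Open Scope ring_scope.

Definition is_ideal (R : comPzRingType) (J : set R) : Prop :=
  [/\ J 0, forall x y, J x -> J y -> J (x + y) & forall a x, J x -> J (a * x)].

Definition ideal_span (R : comPzRingType) (A : set R) : set R :=
  \bigcap_(J in [set J : set R | is_ideal J /\ A `<=` J]) J.

(* [ideal_pow I 0] is the unit ideal. *)
Fixpoint ideal_pow (R : comPzRingType) (I : set R) (n : nat) : set R :=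
  if n is m.+1
  then ideal_span [set x * y | x in I & y in ideal_pow I m]
  else setT.

Definition is_prime_ideal (R : comPzRingType) (P : set R) : Prop :=
  [/\ is_ideal P, ~ P 1 & forall x y, P (x * y) -> P x \/ P y].

Record prime_ideal (R : comPzRingType) := PrimeIdeal {
  prime_set :> set R;
  prime_setP : is_prime_ideal prime_set
}.

Definition Min (R : comPzRingType) (I : set R) : set (prime_ideal R) :=
  [set P : prime_ideal R | I `<=` P /\
     forall Q : prime_ideal R, I `<=` Q -> Q `<=` P -> P `<=` Q].

Record mult_set (R : comPzRingType) := MultSet {
  mult_carrier :> set R;
  mult_carrier1 : mult_carrier 1;
  mult_carrierM : forall x y,
    mult_carrier x -> mult_carrier y -> mult_carrier (x * y)
}.

Section Localization.
Variables (R : comPzRingType) (W : mult_set R).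

Definition mult_set_one : set_type W := SigSub (mem_set (mult_carrier1 W)).

Definition mult_set_mul (s t : set_type W) : set_type W :=
  SigSub (mem_set (mult_carrierM (set_mem (valP s)) (set_mem (valP t)))).

Lemma val_mult_set_one : val mult_set_one = 1. Proof. by []. Qed.

Lemma val_mult_set_mul (s t : set_type W) :
  val (mult_set_mul s t) = val s * val t.
Proof. by []. Qed.

Local Notation valE := (val_mult_set_one, val_mult_set_mul).

Local Notation fraction := (R * set_type W)%type.
Local Notation num x := (x.1).
Local Notation den x := (val x.2).

(* The factor [u] cannot be dropped, since [R] may have zero divisors. *)
Definition loc_equiv (x y : fraction) : bool :=
  `[< exists2 u, (W : set R) u & u * (num x * den y) = u * (num y * den x) >].

Lemma loc_equivP (x y : fraction) :
  reflect (exists2 u, (W : set R) u & u * (num x * den y) = u * (num y * den x))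
          (loc_equiv x y).
Proof. exact: asboolP. Qed.

Lemma denP (x : fraction) : (W : set R) (den x).
Proof. exact: set_mem (valP x.2). Qed.

Lemma loc_equiv_refl : reflexive loc_equiv.
Proof. by move=> x; apply/loc_equivP; exists 1 => //; exact: mult_carrier1. Qed.

Lemma loc_equiv_sym : symmetric loc_equiv.
Proof. by move=> x y; apply/loc_equivP/loc_equivP => -[u Wu e]; exists u. Qed.

Lemma loc_equiv_trans : transitive loc_equiv.
Proof.
move=> y x z /loc_equivP[u Wu e] /loc_equivP[v Wv f]; apply/loc_equivP.
exists (u * v * den y).
  by apply: mult_carrierM (denP y); exact: mult_carrierM.
transitivity (v * den z * (u * (num x * den y))); first by ring.
rewrite e; transitivity (u * den x * (v * (num y * den z))); first by ring.
by rewrite f; ring.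
Qed.

Canonical loc_equiv_equiv :=
  EquivRel loc_equiv loc_equiv_refl loc_equiv_sym loc_equiv_trans.

Definition localization : Type := {eq_quot loc_equiv}%qT.

HB.instance Definition _ : EqQuotient _ loc_equiv localization :=
  EqQuotient.on localization.
HB.instance Definition _ := Choice.on localization.

Definition loc_frac (a : R) (s : set_type W) : localization :=
  (\pi_localization (a, s))%qT.

Lemma loc_frac_eqP (a b : R) (s t : set_type W) :
  loc_frac a s = loc_frac b t <->
  exists2 u, (W : set R) u & u * (a * val t) = u * (b * val s).
Proof. by split=> [/eqmodP/loc_equivP|?] //; apply/eqmodP/loc_equivP. Qed.

Lemma loc_fracP (x : localization) : exists a s, x = loc_frac a s.
Proof. by elim/quotW: x => -[a s]; exists a, s. Qed.

Lemma loc_frac_repr (x : localization) :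
  loc_frac (repr x).1 (repr x).2 = x.
Proof. by rewrite /loc_frac -surjective_pairing reprK. Qed.

Definition loc_add (x y : localization) : localization :=
  loc_frac (num (repr x) * den (repr y) + num (repr y) * den (repr x))
           (mult_set_mul (repr x).2 (repr y).2).

Definition loc_opp (x : localization) : localization :=
  loc_frac (- num (repr x)) (repr x).2.

Definition loc_mul (x y : localization) : localization :=
  loc_frac (num (repr x) * num (repr y))
           (mult_set_mul (repr x).2 (repr y).2).

Lemma loc_addE a s b t : loc_add (loc_frac a s) (loc_frac b t) =
  loc_frac (a * val t + b * val s) (mult_set_mul s t).
Proof.
rewrite /loc_add; set x := repr _; set y := repr _.
have /loc_frac_eqP[u Wu e] : loc_frac x.1 x.2 = loc_frac a s.
  exact: loc_frac_repr.
have /loc_frac_eqP[v Wv f] : loc_frac y.1 y.2 = loc_frac b t.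
  exact: loc_frac_repr.
apply/loc_frac_eqP; exists (u * v); first exact: mult_carrierM.
rewrite !valE.
transitivity (u * (num x * val s) * (v * den y * val t) +
              v * (num y * val t) * (u * den x * val s)); first by ring.
by rewrite e f; ring.
Qed.

Lemma loc_oppE a s : loc_opp (loc_frac a s) = loc_frac (- a) s.
Proof.
rewrite /loc_opp; set x := repr _.
have /loc_frac_eqP[u Wu e] : loc_frac x.1 x.2 = loc_frac a s.
  exact: loc_frac_repr.
by apply/loc_frac_eqP; exists u => //; rewrite !mulNr !mulrN e.
Qed.

Lemma loc_mulE a s b t : loc_mul (loc_frac a s) (loc_frac b t) =
  loc_frac (a * b) (mult_set_mul s t).
Proof.
rewrite /loc_mul; set x := repr _; set y := repr _.
have /loc_frac_eqP[u Wu e] : loc_frac x.1 x.2 = loc_frac a s.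
  exact: loc_frac_repr.
have /loc_frac_eqP[v Wv f] : loc_frac y.1 y.2 = loc_frac b t.
  exact: loc_frac_repr.
apply/loc_frac_eqP; exists (u * v); first exact: mult_carrierM.
rewrite !valE.
transitivity (u * (num x * val s) * (v * (num y * val t))); first by ring.
by rewrite e f; ring.
Qed.

Lemma loc_frac_eq (a b : R) (s t : set_type W) :
  a * val t = b * val s -> loc_frac a s = loc_frac b t.
Proof.
by move=> e; apply/loc_frac_eqP; exists 1; [exact: mult_carrier1|rewrite e].
Qed.

Definition loc_map (a : R) : localization := loc_frac a mult_set_one.

Lemma loc_addA : associative loc_add.
Proof.
move=> x y z; have [a [s ->]] := loc_fracP x; have [b [t ->]] := loc_fracP y.
have [c [r ->]] := loc_fracP z; rewrite !loc_addE; apply: loc_frac_eq.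
by rewrite !valE; ring.
Qed.

Lemma loc_addC : commutative loc_add.
Proof.
move=> x y; have [a [s ->]] := loc_fracP x; have [b [t ->]] := loc_fracP y.
by rewrite !loc_addE; apply: loc_frac_eq; rewrite !valE; ring.
Qed.

Lemma loc_add0 : left_id (loc_map 0) loc_add.
Proof.
move=> x; have [a [s ->]] := loc_fracP x.
by rewrite !loc_addE; apply: loc_frac_eq; rewrite !valE; ring.
Qed.

Lemma loc_addN : left_inverse (loc_map 0) loc_opp loc_add.
Proof.
move=> x; have [a [s ->]] := loc_fracP x.
by rewrite loc_oppE !loc_addE; apply: loc_frac_eq; rewrite !valE; ring.
Qed.

HB.instance Definition _ :=
  GRing.isZmodule.Build localization loc_addA loc_addC loc_add0 loc_addN.

Lemma loc_mulA : associative loc_mul.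
Proof.
move=> x y z; have [a [s ->]] := loc_fracP x; have [b [t ->]] := loc_fracP y.
have [c [r ->]] := loc_fracP z; rewrite !loc_mulE; apply: loc_frac_eq.
by rewrite !valE; ring.
Qed.

Lemma loc_mulC : commutative loc_mul.
Proof.
move=> x y; have [a [s ->]] := loc_fracP x; have [b [t ->]] := loc_fracP y.
by rewrite !loc_mulE; apply: loc_frac_eq; rewrite !valE; ring.
Qed.

Lemma loc_mul1 : left_id (loc_map 1) loc_mul.
Proof.
move=> x; have [a [s ->]] := loc_fracP x.
by rewrite !loc_mulE; apply: loc_frac_eq; rewrite !valE; ring.
Qed.

Lemma loc_mulDl : left_distributive loc_mul loc_add.
Proof.
move=> x y z; have [a [s ->]] := loc_fracP x; have [b [t ->]] := loc_fracP y.
have [c [r ->]] := loc_fracP z; rewrite !(loc_mulE, loc_addE).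
by apply: loc_frac_eq; rewrite !valE; ring.
Qed.

HB.instance Definition _ := GRing.Zmodule_isComPzRing.Build localization
  loc_mulA loc_mulC loc_mul1 loc_mulDl.

Lemma loc_map_is_zmod_morphism : zmod_morphism loc_map.
Proof.
move=> a b; rewrite {3}/loc_map; change (loc_map (a - b) =
  loc_add (loc_map a) (loc_opp (loc_map b))).
by rewrite loc_oppE loc_addE; apply: loc_frac_eq; rewrite !valE; ring.
Qed.

Lemma loc_map_is_monoid_morphism : monoid_morphism loc_map.
Proof.
split=> // a b; change (loc_map (a * b) = loc_mul (loc_map a) (loc_map b)).
by rewrite loc_mulE; apply: loc_frac_eq; rewrite !valE; ring.
Qed.

HB.instance Definition _ := GRing.isZmodMorphism.Build R localization loc_map
  loc_map_is_zmod_morphism.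
HB.instance Definition _ := GRing.isMonoidMorphism.Build R localization loc_map
  loc_map_is_monoid_morphism.

End Localization.

(* A commutative [k]-algebra is a commutative ring [A] with a ring morphism
   [k -> A]; unlike with [comAlgType k], the zero algebra is allowed. *)
Definition fin_gen_algebra (k : fieldType) (A : comPzRingType)
    (iota : {rmorphism k -> A}) : Prop :=
  exists g : seq A, forall S : {pred A}, GRing.subring_closed S ->
    (forall c : k, iota c \in S) -> {subset g <= S} ->
    forall x : A, x \in S.

Definition ess_finite_type (k : fieldType) (R : comPzRingType) : Prop :=
  exists (R0 : comPzRingType) (iota : {rmorphism k -> R0}) (W : mult_set R0),
    fin_gen_algebra iota /\
    exists f : {rmorphism localization W -> R}, bijective f.

Lemma prime_compl1 (R : comPzRingType) (P : prime_ideal R) : (~` (P : set R)) 1.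
Proof. by case: (@prime_setP R P). Qed.

Lemma prime_complM (R : comPzRingType) (P : prime_ideal R) (x y : R) :
  (~` (P : set R)) x -> (~` (P : set R)) y ->
  (~` (P : set R)) (x * y).
Proof. by case: (@prime_setP R P) => _ _ PM Px Py /PM[]. Qed.

Definition prime_compl (R : comPzRingType) (P : prime_ideal R) : mult_set R :=
  @MultSet R (~` (P : set R)) (@prime_compl1 R P) (@prime_complM R P).

(* If [I] is the unit ideal then [Min I] is empty and the intersection is the
   whole ring. *)
Definition symbolic_power (R : comPzRingType) (I : set R) (n : nat) : set R :=
  \bigcap_(P in Min I)
    [set x : R | ideal_span (loc_map (prime_compl P) @` ideal_pow I n)
                            (loc_map (prime_compl P) x)].

(* The value is [+oo] when there is no finite generating set: infinite
   cardinalities are not distinguished from one another. *)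
Definition mu (K : realType) (R : comPzRingType) (J : set R) : \bar K :=
  ereal_inf [set (#|` A|%:R)%:E | A in
    [set A : {fset R} | ideal_span [set` A] = J]].

(* [u n = O(n ^ s)]; no absolute value is taken, [u] being nonnegative here. *)
Definition is_bigO_pow (K : realType) (u : nat -> \bar K) (s : K) : Prop :=
  exists C : K, \forall n \near \oo, (u n <= (C * n%:R `^ s)%:E)%E.

Definition symbolic_analytic_spread (K : realType) (R : comPzRingType)
    (I : set R) : \bar K :=
  ereal_inf [set t%:E | t in
    [set t : K | is_bigO_pow (fun n => mu K (symbolic_power I n)) (t - 1)]].

(* Main.v *)
From HB Require Import structures.
Require Import Defs.
From mathcomp Require Import all_boot all_order all_algebra.
From mathcomp Require Import all_classical all_reals all_analysis.
From mathcomp Require Import finmap zify ring.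

(* Write [R] as fractions of elements of a polynomial ring [S] over [k]. Up to
   these fractions, the [n]-th symbolic power of [I] becomes the set of [f] in [S]
   such that every minimal prime [P] misses some [s] with [s f] in
   [Q_n = (g)^n + a], where [g] generates the preimage of [I] and [a] is the kernel
   of [S -> R].

   The Rees algebra of [(g)] is Noetherian, so for each [P] the torsion of the
   associated graded ring away from [P] is killed by a single [h] outside [P];
   climbing the filtration, [h^n f] is in [Q_n] as soon as [s f] is for some [s]
   outside [P]. Finitely many [h_i] suffice for all [P], hence the symbolic power
   is the conductor of the [h_i^n] into [Q_n], the projection of the kernel of a
   matrix over [S] whose size and degrees grow polynomially with [n].

   For a fixed number of variables, such a kernel has polynomially many generators
   (Hermann): after a Nagata change of variables a maximal minor is monic in the
   last variable, and dividing by it bounds the degree of the kernel vectors in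
   that variable, which leaves a larger linear system in one variable less. *)

Set Implicit Arguments.
Unset Strict Implicit.
Unset Printing Implicit Defensive.

Import Order.TTheory GRing.Theory Num.Theory.

Local Open Scope classical_set_scope.
Local Open Scope ring_scope.

(** * Degree bounds *)

(** [bd D a] reads: [a] has degree at most [D]. Keeping the predicate abstract lets the same
    determinant estimates serve at every stage of the induction on variables. *)
Record degree_filtration (A : comNzRingType) (bd : nat -> A -> Prop) : Prop := {
  bd0 : forall D, bd D 0;
  bd1 : forall D, bd D 1;
  bd_le : forall D E a, (D <= E)%N -> bd D a -> bd E a;
  bdB : forall D a b, bd D a -> bd D b -> bd D (a - b);
  bdM : forall D E a b, bd D a -> bd E b -> bd (D + E)%N (a * b)
}.

Section Filtration.
Variables (A : comNzRingType) (bd : nat -> A -> Prop).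
Hypothesis hbd : degree_filtration bd.

Lemma bdN D a : bd D a -> bd D (- a).
Proof. by rewrite -sub0r; apply: (bdB hbd); apply: (bd0 hbd). Qed.

Lemma bdD D a b : bd D a -> bd D b -> bd D (a + b).
Proof. by move=> ha hb; rewrite -[b]opprK; apply: (bdB hbd) => //; exact: bdN. Qed.

Lemma bd_sum D I (r : seq I) (P : pred I) (F : I -> A) :
  (forall i, P i -> bd D (F i)) -> bd D (\sum_(i <- r | P i) F i).
Proof.
by move=> h; apply: (big_ind (bd D)) => //; [exact: (bd0 hbd)|exact: bdD].
Qed.

Lemma bdX D a n : bd D a -> bd (n * D)%N (a ^+ n).
Proof.
move=> h; elim: n => [|n IH]; first by rewrite expr0; exact: (bd1 hbd).
by rewrite exprS mulSn; apply: (bdM hbd).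
Qed.

Lemma bd_prod D (I : finType) (F : I -> A) :
  (forall i, bd D (F i)) -> bd (#|I| * D)%N (\prod_i F i).
Proof.
move=> h; rewrite cardE -big_enum /=.
elim: (enum I) => [|i s IH]; first by rewrite big_nil; exact: (bd1 hbd).
by rewrite big_cons mulSn; apply: (bdM hbd).
Qed.

Lemma bd_sign D n : bd D ((-1) ^+ n).
Proof.
elim: n => [|n IH]; first by rewrite expr0; exact: (bd1 hbd).
by rewrite exprS mulN1r; exact: bdN.
Qed.

Lemma bd_det D n (M : 'M[A]_n) :
  (forall i j, bd D (M i j)) -> bd (n * D)%N (\det M).
Proof.
move=> h; apply: bd_sum => s _; rewrite -[(n * D)%N]add0n; apply: (bdM hbd).
  exact: bd_sign.
by rewrite -{1}[n]card_ord; exact: bd_prod.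
Qed.

Lemma bd_adj D n (M : 'M[A]_n) :
  (forall i j, bd D (M i j)) -> forall i j, bd (n * D)%N (\adj M i j).
Proof.
move=> h i j; rewrite mxE /cofactor -[(n * D)%N]add0n; apply: (bdM hbd).
  exact: bd_sign.
apply: (@bd_le _ _ hbd (n.-1 * D)%N); first by rewrite leq_mul2r leq_pred orbT.
by apply: bd_det => a b; rewrite !mxE.
Qed.

(** One [D] bounds both the new variable and the coefficients, so iteration measures the degree in
    each variable separately, not the total degree. *)
Definition poly_bd (D : nat) (f : {poly A}) : Prop :=
  (size f <= D.+1)%N /\ forall i, bd D f`_i.

Lemma poly_bd_filtration : degree_filtration poly_bd.
Proof.
split.
- by move=> D; split=> [|i]; rewrite ?size_poly0 ?coef0 //; exact: (bd0 hbd).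
- move=> D; split=> [|i]; rewrite ?size_poly1 // coef1.
  by case: (i == 0)%N; [exact: (bd1 hbd)|exact: (bd0 hbd)].
- move=> D E a DE [h1 h2]; split=> [|i]; first exact: leq_trans h1 _.
  exact: (bd_le hbd DE).
- move=> D a b [a1 a2] [b1 b2]; split=> [|i].
    by apply: leq_trans (size_polyD _ _) _; rewrite size_polyN geq_max a1.
  by rewrite coefB; apply: (bdB hbd).
- move=> D E a b [a1 a2] [b1 b2]; split=> [|i].
    by apply: leq_trans (size_polyMleq _ _) _; lia.
  by rewrite coefM; apply: bd_sum => j _; apply: (bdM hbd).
Qed.

Lemma poly_bdC D a : bd D a -> poly_bd D a%:P.
Proof.
move=> h; split=> [|i]; first by rewrite (leq_trans (size_polyC_leq1 _)).
by rewrite coefC; case: (i == 0)%N => //; exact: (bd0 hbd).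
Qed.

Lemma poly_bdXn n : poly_bd n 'X^n.
Proof.
split=> [|i]; first by rewrite size_polyXn.
by rewrite coefXn; case: (i == n)%N; [exact: (bd1 hbd)|exact: (bd0 hbd)].
Qed.

End Filtration.

Lemma poly_bd_map_polyC (A : comNzRingType) (bd : nat -> A -> Prop) D (f : {poly A}) :
  degree_filtration bd -> poly_bd bd D f ->
  poly_bd (poly_bd bd) D (map_poly polyC f).
Proof.
move=> hbd [h1 h2]; split=> [|i]; first by rewrite size_map_polyC.
by rewrite coef_map; exact: poly_bdC.
Qed.

Lemma poly_ext (A : comNzRingType) (B : comNzRingType) (f : {rmorphism A -> B})
    (b : B) : exists g : {rmorphism {poly A} -> B},
  (forall a, g a%:P = f a) /\ g 'X = b.
Proof.
have cfb : commr_rmorph f b by move=> x; exact: mulrC.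
exists (horner_morph cfb); split=> [a|]; first exact: horner_morphC.
exact: horner_morphX.
Qed.

Lemma poly_rmorphE (A : comNzRingType) (B : pzRingType)
    (g : {rmorphism {poly A} -> B}) (f : {poly A}) :
  g f = \sum_(i < size f) g (f`_i)%:P * g 'X ^+ i.
Proof.
rewrite -[in LHS](coefK f) poly_def rmorph_sum; apply: eq_bigr => i _.
by rewrite -mul_polyC rmorphM rmorphXn.
Qed.

Lemma poly_rmorph_ext (A : comNzRingType) (B : pzRingType)
    (g h : {rmorphism {poly A} -> B}) :
  (forall a, g a%:P = h a%:P) -> g 'X = h 'X -> g =1 h.
Proof.
move=> e1 e2 f; rewrite [LHS]poly_rmorphE [RHS]poly_rmorphE e2; apply: eq_bigr => i _.
by rewrite e1.
Qed.

(** * Leading units and the Nagata change of variables *)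

Section LeadingUnit.
Variable B : idomainType.
Implicit Types F L : {poly B}.

(** The residue of the degree is recorded because terms with distinct residues modulo [d] have
    distinct degrees, so their leading terms cannot cancel. *)
Definition lead_unit_deg (d r : nat) F : Prop :=
  [/\ F != 0, lead_coef F \is a GRing.unit & (size F).-1 = r %[mod d]].

Lemma lead_unit_degD d r r' F G : r <> r' %[mod d] ->
  lead_unit_deg d r F -> lead_unit_deg d r' G ->
  lead_unit_deg d r (F + G) \/ lead_unit_deg d r' (F + G).
Proof.
move=> rr' [F0 Fu Fr] [G0 Gu Gr].
have hlt (P Q : {poly B}) b : (size P < size Q)%N -> lead_unit_deg d b Q ->
    lead_unit_deg d b (Q + P).
  move=> PQ [Q0 Qu Qr]; split; last by rewrite size_polyDl.
    by rewrite -size_poly_eq0 size_polyDl // size_poly_eq0.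
  by rewrite lead_coefDl.
have [e|e|e] := ltngtP (size F) (size G).
- by right; rewrite [F + G]addrC; exact: hlt.
- by left; exact: hlt.
- by case: rr'; rewrite -Fr -Gr e.
Qed.

(** A nonzero [F j] has degree a multiple of [w * e.+1] and [L ^+ j] has degree [w * j], so for
    [j <= e] the nonzero summands fall in distinct classes modulo [w * e.+1]. *)
Lemma lead_unit_deg_sum (w e : nat) (F : nat -> {poly B}) L :
  (0 < w)%N -> L \is monic -> size L = w.+1 ->
  (forall j, F j = 0 \/ lead_unit_deg (w * e.+1) 0 (F j)) ->
  forall m, (m <= e.+1)%N ->
  let s := \sum_(j < m) F j * L ^+ j in
  (s = 0 /\ forall j, (j < m)%N -> F j = 0) \/
  exists2 j, (j < m)%N & lead_unit_deg (w * e.+1) (w * j) s.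
Proof.
move=> w0 Lm Ls hF; elim=> [|m IH] hm /=; first by left; rewrite big_ord0.
rewrite big_ord_recr /=.
have hm' : F m = 0 \/ lead_unit_deg (w * e.+1) (w * m) (F m * L ^+ m).
  case: (hF m) => [->|[F0 Fu Fr]]; [by left|right; split].
  - by rewrite mulf_neq0 ?expf_neq0 //; exact: monic_neq0.
  - by rewrite lead_coef_Mmonic ?monic_exp.
  - rewrite size_Mmonic ?monic_exp // (polySpred F0).
    rewrite (polySpred (monic_neq0 (monic_exp m Lm))) size_exp Ls addSn addnS /=.
    by rewrite -modnDml Fr mod0n add0n.
case: (IH (ltnW hm)) => /= [[-> h0]|[j jm h]]; rewrite ?add0r.
  case: hm' => [Fm0|h]; [left|by right; exists m].
  rewrite Fm0 mul0r; split=> // j; rewrite ltnS leq_eqVlt => /orP[/eqP->//|].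
  exact: h0.
right; case: hm' => [->|h']; first by rewrite mul0r addr0; exists j => //; lia.
have jm' : (w * j)%N <> (w * m)%N %[mod w * e.+1].
  rewrite -!muln_modr => /eqP; rewrite eqn_pmul2l // !modn_small; lia.
by case: (lead_unit_degD jm' h h') => ?; [exists j|exists m] => //; lia.
Qed.

Lemma lead_unit_sum (w e : nat) (F : nat -> {poly B}) L n :
  (0 < w)%N -> L \is monic -> size L = w.+1 ->
  (forall j, F j = 0 \/ lead_unit_deg (w * e.+1) 0 (F j)) ->
  (n <= e)%N -> F n != 0 ->
  lead_unit_deg w 0 (\sum_(j < n.+1) F j * L ^+ j).
Proof.
move=> w0 Lm Ls hF ne Fn.
case: (@lead_unit_deg_sum w e F L w0 Lm Ls hF n.+1) => //= [[_ h]|[j _ [h1 h2 h3]]].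
  by rewrite h ?eqxx // in Fn.
(* The residue [w * j] modulo [w * e.+1] becomes [0] modulo the divisor [w]. *)
split=> //; apply/eqP; rewrite mod0n -/(dvdn w _).
have : (w %| (w * j))%N by exact: dvdn_mulr.
rewrite /dvdn -[X in X == _](modn_dvdm _ (dvdn_mulr e.+1 (dvdnn w))) -h3.
by rewrite modn_dvdm // dvdn_mulr.
Qed.

End LeadingUnit.

(* For [A = k[z_1, ..., z_r]] the automorphism is [z_i |-> z_i + 'X^(w_i)] with
   the weights [w, w (e + 1), w (e + 1)^2, ...]: monomials of degree at most [e]
   in each variable then get distinct degrees in ['X]. *)
Definition nagata (A : idomainType) (bd : nat -> A -> Prop) : Prop :=
  exists c, forall X w e, (1 < X)%N -> (0 < w <= X)%N -> (e <= X)%N ->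
  exists s s' : {rmorphism {poly A} -> {poly A}},
  [/\ s 'X = 'X /\ s' 'X = 'X, cancel s s', cancel s' s,
      forall a, a != 0 -> bd e a -> lead_unit_deg w 0 (s a%:P) &
      forall a, bd X a -> poly_bd bd (X ^ c)%N (s a%:P)].

Lemma nagata_field (k : fieldType) : nagata (fun _ (_ : k) => True).
Proof.
exists 0%N => X w e X1 w0 eX; exists idfun, idfun; split=> //.
  by move=> a a0 _; split; rewrite ?polyC_eq0 ?lead_coefC ?unitfE ?size_polyC ?a0.
by move=> a _; split=> //; rewrite (leq_trans (size_polyC_leq1 _)).
Qed.

(** With [z] the variable adjoined to [A], the inductive automorphism is taken with weight
    [w * e.+1] and extended by [z |-> z + 'X^w]. The powers of [z + 'X^w] are monic in ['X] of
    degrees [w * j], as [lead_unit_sum] requires. *)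
Lemma nagata_poly (A : idomainType) (bd : nat -> A -> Prop) :
  degree_filtration bd -> nagata bd -> nagata (poly_bd bd).
Proof.
(* The inductive call has weight [w * e.+1], at most [X ^ 3], whence [3 * c]; the extra [3] absorbs
   the degree, at most [X * w], of the powers of [z + 'X^w]. *)
move=> hbd [c hc]; exists (3 * c + 3)%N => X w e X1 /andP[w0 wX] eX.
have X3 : (w * e.+1 <= X ^ 3)%N.
  apply: (@leq_trans (X * (X * X))%N); last by rewrite !expnS expn0 muln1.
  by apply: leq_mul => //; nia.
have XX : (X <= X ^ 3)%N by rewrite -{1}[X]expn1 leq_pexp2l //; lia.
have [s [s' [[sX s'X] ss' s's slead sbd]]] :
  exists s s' : {rmorphism {poly A} -> {poly A}},
  [/\ s 'X = 'X /\ s' 'X = 'X, cancel s s', cancel s' s,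
      forall a, a != 0 -> bd e a -> lead_unit_deg (w * e.+1) 0 (s a%:P) &
      forall a, bd (X ^ 3)%N a -> poly_bd bd ((X ^ 3) ^ c)%N (s a%:P)].
  by apply: hc; [exact: leq_trans XX|rewrite muln_gt0 w0 X3|exact: leq_trans XX].
(* [i] embeds [A['X]] into [A[z]['X]], keeping ['X] as the outer variable. *)
pose i : {rmorphism {poly A} -> {poly {poly A}}} := map_poly polyC.
have iX : i 'X = 'X by rewrite /= map_polyX.
have iC a : i a%:P = a%:P%:P by rewrite /= map_polyC.
(* [t] is defined on [A[z]] and [T] extends it by fixing the outer ['X]; the inverse [T'] is built
   in the same way from [s'] and [z |-> z - 'X^w]. *)
have [t [tC tX]] := poly_ext (i \o s \o polyC) ('X%:P + 'X^w).
have [t' [t'C t'X]] := poly_ext (i \o s' \o polyC) ('X%:P - 'X^w).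
have [T [TC TX]] := poly_ext t 'X.
have [T' [T'C T'X]] := poly_ext t' 'X.
have Ti f : T (i f) = i (s f).
  apply: (@poly_rmorph_ext _ _ (T \o i) (i \o s)) => [a|] /=.
    by rewrite map_polyC TC tC.
  by rewrite sX !map_polyX TX.
have T'i f : T' (i f) = i (s' f).
  apply: (@poly_rmorph_ext _ _ (T' \o i) (i \o s')) => [a|] /=.
    by rewrite map_polyC T'C t'C.
  by rewrite s'X !map_polyX T'X.
exists T, T'; split=> //.
- move=> f; apply: (@poly_rmorph_ext _ _ (T' \o T) idfun) => [g|] /=; last first.
    by rewrite TX T'X.
  rewrite TC; apply: (@poly_rmorph_ext _ _ (T' \o t) polyC) => [a|] /=.
    by rewrite tC /= T'i ss' iC.
  by rewrite tX rmorphD rmorphXn T'C t'X T'X subrK.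
- move=> f; apply: (@poly_rmorph_ext _ _ (T \o T') idfun) => [g|] /=; last first.
    by rewrite T'X TX.
  rewrite T'C; apply: (@poly_rmorph_ext _ _ (T \o t') polyC) => [a|] /=.
    by rewrite t'C /= Ti s's iC.
  by rewrite t'X rmorphB rmorphXn TC tX TX addrK.
- move=> f f0 [fe fbd]; rewrite TC poly_rmorphE tX (polySpred f0).
  have -> : \sum_(j < (size f).-1.+1) t (f`_j)%:P * ('X%:P + 'X^w) ^+ j =
      \sum_(j < (size f).-1.+1) i (s (f`_j)%:P) * ('X%:P + 'X^w) ^+ j.
    by apply: eq_bigr => j _; rewrite tC.
  have sL : (size ('X%:P : {poly {poly A}}) < size ('X^w : {poly {poly A}}))%N.
    by rewrite size_polyXn (leq_ltn_trans (size_polyC_leq1 _)).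
  apply: (@lead_unit_sum _ w e (fun j => i (s (f`_j)%:P))) => //.
  + by rewrite addrC monicE lead_coefDl // lead_coefXn.
  + by rewrite addrC size_polyDl // size_polyXn.
  + move=> j; have [->|fj] := eqVneq f`_j 0; first by left; rewrite !rmorph0.
    right; have [h1 h2 h3] := slead _ fj (fbd j).
    by split; rewrite ?map_polyC_eq0 ?size_map_polyC // lead_coef_map_inj ?rmorph_unit //; exact: polyC_inj.
  + by rewrite -ltnS -polySpred.
  + have : f`_(size f).-1 != 0 by rewrite -lead_coefE lead_coef_eq0.
    move=> h; have [h1 _ _] := slead _ h (fbd _).
    by rewrite map_polyC_eq0.
- move=> f [fX fbd]; rewrite TC poly_rmorphE.
  have hbd2 := poly_bd_filtration hbd.
  have hbd3 := poly_bd_filtration hbd2.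
  apply: (bd_sum hbd3) => j _.
  apply: (@bd_le _ _ hbd3 ((X ^ 3) ^ c + X * w)%N).
    rewrite expnD expnM.
    have : (X * w <= X ^ 2)%N by rewrite expnS expn1 leq_mul2l wX orbT.
    have : (0 < (X ^ 3) ^ c)%N by rewrite !expn_gt0; lia.
    move: ((X ^ 3) ^ c)%N => Y; rewrite !expnS expn0; nia.
  apply: (bdM hbd3).
    rewrite tC; apply: (poly_bd_map_polyC hbd); apply: sbd.
    exact: (bd_le hbd XX).
  apply: (@bd_le _ _ hbd3 (j * w)%N).
    by rewrite leq_mul2r; apply/orP; right; have := ltn_ord j; lia.
  rewrite tX; apply: (bdX hbd3); apply: (bdD hbd3).
    apply: (poly_bdC hbd2); apply: (@bd_le _ _ hbd2 1%N) => //.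
    by rewrite -['X]expr1; exact: poly_bdXn.
  exact: poly_bdXn.
Qed.

(** * Generators of kernels of polynomial matrices *)

(* [d] is a maximal nonzero minor of [M] and [K = d - G * adj M2 * M1], where [M1]
   collects the rows of the minor, [M2 = M1 * G] is its matrix and [G] selects its
   columns. *)
Lemma cramer_kernel (A : idomainType) (bd : nat -> A -> Prop) (p n D : nat)
    (M : 'M[A]_(p, n)) :
  degree_filtration bd -> (forall i j, bd D (M i j)) ->
  exists (d : A) (K : 'M[A]_n),
  [/\ d != 0, bd (p.+1 * D)%N d, forall i j, bd (p.+1 * D)%N (K i j),
      M *m K = 0 & forall v : 'cV_n, M *m v = 0 -> K *m v = d *: v].
Proof.
(* The rank and the independent rows and columns are taken over the fraction field; injectivity of
   [tofrac] brings the conclusions back to [A]. *)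
move=> hbd hM; pose MF := map_mx (@FracField.tofrac A) M.
pose f := maxrankfun MF.
have Bfull : row_full (rowsub f MF)^T by rewrite /row_full mxrank_tr; exact: maxrowsub_free.
pose g := fullrankfun Bfull.
pose M1 := rowsub f M; pose G : 'M[A]_(n, _) := colsub g 1%:M.
pose M2 := M1 *m G; pose K := (\det M2)%:M - G *m (\adj M2 *m M1).
have rp : (\rank MF <= p)%N := rank_leq_row MF.
have G01 i j D' : bd D' (G i j).
  by rewrite !mxE; case: eqP => _; [exact: (bd1 hbd)|exact: (bd0 hbd)].
have M2bd i j : bd D (M2 i j).
  rewrite mxE; apply: (bd_sum hbd) => a _; rewrite -[D]addn0.
  by apply: (bdM hbd) => //; rewrite mxE.
have dbd : bd (\rank MF * D)%N (\det M2) by exact: bd_det.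
have M1K : M1 *m K = 0.
  rewrite mulmxBr mul_mx_scalar !mulmxA -/M2 mul_mx_adj mul_scalar_mx.
  by rewrite subrr.
exists (\det M2), K; split.
- suff : \det (map_mx (@FracField.tofrac A) M2) != 0.
    by rewrite det_map_mx tofrac_eq0.
  have := fullrowsub_unit Bfull; rewrite unitmxE unitfE -det_tr.
  congr (\det _ != 0); rewrite /M2 /G mulmx_colsub mulmx1 -/g.
  by apply/matrixP => i j; rewrite !mxE.
- apply: (bd_le hbd _ dbd); nia.
- move=> i j; rewrite !mxE; apply: (bdB hbd).
    case: eqP => _; rewrite ?mulr1n ?mulr0n; last exact: (bd0 hbd).
    by apply: (bd_le hbd _ dbd); nia.
  apply: (bd_sum hbd) => a _; rewrite -[(_ * D)%N]add0n; apply: (bdM hbd) => //.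
  rewrite mxE; apply: (bd_sum hbd) => b _.
  apply: (@bd_le _ _ hbd (\rank MF * D + D)%N); first by nia.
  by apply: (bdM hbd); [exact: bd_adj|rewrite mxE].
(* Over the fraction field every row of [M] is a combination of the rows of [M1], which [K]
   kills. *)
- have e : map_mx (@FracField.tofrac A) (M *m K) = 0.
    have /submxP[C MC] : (MF <= rowsub f MF)%MS by rewrite eq_maxrowsub.
    by rewrite map_mxM -/MF MC -mulmxA -map_mxsub -map_mxM M1K map_mx0 mulmx0.
  apply/matrixP => i j; move/matrixP/(_ i j): e; rewrite [in LHS]mxE [in RHS]mxE.
  by move/eqP; rewrite tofrac_eq0 => /eqP->; rewrite mxE.
- move=> v Mv; rewrite mulmxBl mul_scalar_mx -!mulmxA.
  have -> : M1 *m v = 0.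
    by rewrite /M1 mul_rowsub_mx Mv; apply/matrixP => i j; rewrite !mxE.
  by rewrite !mulmx0 subr0.
Qed.

Definition ffun_scale (A : nzRingType) (J : finType) (a : A) (v : {ffun J -> A}) :
  {ffun J -> A} := [ffun j => a * v j].

Definition submodule_set (A : nzRingType) (J : finType) (N : set {ffun J -> A}) : Prop :=
  [/\ N 0, forall x y, N x -> N y -> N (x + y) &
      forall a x, N x -> N (ffun_scale a x)].

Definition in_kernel (A : nzRingType) (I J : finType) (M : I -> J -> A)
    (v : J -> A) : Prop :=
  forall i, \sum_j M i j * v j = 0.

(** Generation is tested on arbitrary submodules: it is then transported along a truncation of
    coefficients or a ring automorphism by pulling a submodule back. *)
Definition kernel_gens (A : nzRingType) (I J : finType) (M : I -> J -> A)
    (s : seq {ffun J -> A}) : Prop :=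
  (forall v, v \in s -> in_kernel M v) /\
  forall N : set {ffun J -> A}, submodule_set N -> (forall v, v \in s -> N v) ->
    forall v : {ffun J -> A}, in_kernel M v -> N v.

(** A single [X] bounds rows, columns and degrees. As [1 < X], constants and sums are absorbed into
    powers of [X], and only an exponent has to be tracked. *)
Definition poly_kernel_gens (A : nzRingType) (bd : nat -> A -> Prop) : Prop :=
  exists c, forall X, (1 < X)%N -> forall (I J : finType) (M : I -> J -> A),
    (#|I| <= X)%N -> (#|J| <= X)%N -> (forall i j, bd X (M i j)) ->
    exists2 s, (size s <= X ^ c)%N & kernel_gens M s.

Lemma submodule_set_sum (A : nzRingType) (J L : finType) (N : set {ffun J -> A})
    (q : L -> A) (f : L -> {ffun J -> A}) :
  submodule_set N -> (forall l, N (f l)) -> N (\sum_l ffun_scale (q l) (f l)).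
Proof.
move=> [N0 ND NZ] hf; apply: (big_ind N) => // l _; exact: NZ.
Qed.

Lemma cramer_kernel_fin (A : idomainType) (bd : nat -> A -> Prop) (I J : finType)
    (D : nat) (M : I -> J -> A) :
  degree_filtration bd -> (forall i j, bd D (M i j)) ->
  exists (d : A) (K : J -> J -> A),
  [/\ d != 0, bd (#|I|.+1 * D)%N d, forall i j, bd (#|I|.+1 * D)%N (K i j),
      forall i j, \sum_k M i k * K k j = 0 &
      forall v, in_kernel M v -> forall j, \sum_k K j k * v k = d * v j].
Proof.
move=> hbd hM.
pose P : 'M[A]_(#|I|, #|J|) := \matrix_(i, j) M (enum_val i) (enum_val j).
have [|d [K [d0 dbd Kbd PK Kv]]] := @cramer_kernel A bd _ _ D P hbd.
  by move=> i j; rewrite mxE.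
exists d, (fun i j => K (enum_rank i) (enum_rank j)); split=> //.
- move=> i j; have /matrixP/(_ (enum_rank i) (enum_rank j)) := PK.
  rewrite !mxE => e; rewrite -[RHS]e (reindex_onto (@enum_val J J) enum_rank) /=; last first.
    by move=> k _; rewrite enum_rankK.
  apply: eq_big => [k|k _]; first by rewrite enum_valK eqxx.
  by rewrite mxE enum_rankK enum_valK.
- move=> v vM j; pose w : 'cV[A]_#|J| := \col_k v (enum_val k).
  have Pw : P *m w = 0.
    apply/matrixP => i a; rewrite !mxE -[RHS](vM (enum_val i)).
    rewrite [RHS](reindex_onto (@enum_val J J) enum_rank) /=; last first.
      by move=> k _; rewrite enum_rankK.
    apply: eq_big => [k|k _]; first by rewrite enum_valK eqxx.
    by rewrite !mxE.
  have /matrixP/(_ (enum_rank j) 0) := Kv w Pw; rewrite !mxE enum_rankK => <-.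
  rewrite (reindex_onto (@enum_val J J) enum_rank) /=; last first.
    by move=> k _; rewrite enum_rankK.
  apply: eq_big => [k|k _]; first by rewrite enum_valK eqxx.
  by rewrite mxE enum_valK.
Qed.

(** Over a field [d] is invertible, so [K v = d v] writes a kernel vector [v] as a combination of
    the columns of [K]. *)
Lemma poly_kernel_gens_field (k : fieldType) :
  poly_kernel_gens (fun _ (_ : k) => True).
Proof.
exists 1%N => X X1 I J M IX JX _.
have hbd : degree_filtration (fun _ (_ : k) => True) by [].
have [//|d [K [d0 _ _ MK Kv]]] := @cramer_kernel_fin k _ I J 0 M hbd.
pose col j := [ffun i => K i j].
exists [seq col j | j <- enum J]; first by rewrite size_map -cardE expn1.
split=> [v /mapP[j _ ->] i|N Nsub hN v /Kv vK].
  by rewrite -[RHS](MK i j); apply: eq_bigr => l _; rewrite ffunE.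
have -> : v = \sum_j ffun_scale (d^-1 * v j) (col j).
  apply/ffunP => i; rewrite sum_ffunE.
  transitivity (d^-1 * \sum_j K i j * v j).
    by rewrite vK mulKf.
  by rewrite mulr_sumr; apply: eq_bigr => j _; rewrite !ffunE /=; ring.
apply: submodule_set_sum => // j; apply: hN; apply: map_f; exact: mem_enum.
Qed.

Section KernelOverPoly.
Variables (A : idomainType) (I J : finType).

Section Truncated.
Variables (n : nat) (M : I -> J -> {poly A}).

Definition poly_of_coefs (w : {ffun J * 'I_n.+1 -> A}) : {ffun J -> {poly A}} :=
  [ffun j => \poly_(e < n.+1) w (j, inord e)].

(** Row [(i, t)] is the coefficient of ['X^t] in equation [i]. When entries and unknowns have size
    at most [n.+1], the coefficients from [n.+1 + n.+1] on vanish. *)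
Definition coef_system (i : I * 'I_(n.+1 + n.+1)) (j : J * 'I_n.+1) : A :=
  if (j.2 <= i.2)%N then (M i.1 j.1)`_(i.2 - j.2) else 0.

Lemma coef_systemP (w : {ffun J * 'I_n.+1 -> A}) :
  (forall i j, size (M i j) <= n.+1)%N ->
  in_kernel coef_system w <-> in_kernel M (poly_of_coefs w).
Proof.
move=> hM.
have E i t : (\sum_j M i j * poly_of_coefs w j)`_t =
    \sum_j \sum_(e < n.+1)
      (if (e <= t)%N then (M i j)`_(t - e) else 0) * w (j, e).
  rewrite coef_sum; apply: eq_bigr => j _; rewrite coefMr ffunE.
  under eq_bigr => e _ do rewrite coef_poly.
  rewrite -(big_mkord xpredT (fun e => (M i j)`_(t - e) *
    (if (e < n.+1)%N then w (j, inord e) else 0))).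
  (* Both sums are extended to the common range [t.+1 + n.+1], where the added terms vanish. *)
  transitivity (\sum_(0 <= e < t.+1 + n.+1) (if (e <= t)%N then (M i j)`_(t - e) else 0) *
      (if (e < n.+1)%N then w (j, inord e) else 0)).
    rewrite [RHS](@big_cat_nat _ _ _ t.+1) //= ?leq_addr //.
    rewrite [X in _ = _ + X]big1_seq ?addr0; last first.
      move=> e /=; rewrite mem_index_iota => /andP[te _]; by rewrite leqNgt te mul0r.
    by apply: eq_big_nat => e /andP[_ h]; rewrite ltnS in h; rewrite h.
  rewrite [LHS](@big_cat_nat _ _ _ n.+1) //= ?leq_addl //.
  rewrite [X in _ + X = _]big1_seq ?addr0; last first.
    move=> e /=; rewrite mem_index_iota => /andP[te _]; by rewrite ltnNge te mulr0.
  by rewrite big_mkord; apply: eq_bigr => e _; rewrite ltn_ord inord_val.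
split=> [h i|h [i t]].
  apply/polyP => t; rewrite coef0; case: (ltnP t (n.+1 + n.+1)) => ht.
    rewrite E pair_big /= -[RHS](h (i, Ordinal ht)).
    by apply: eq_bigr => -[j e] _.
  rewrite nth_default // (leq_trans _ ht) //.
  apply: (leq_trans (size_sum _ _ _)); apply/bigmax_leqP => j _.
  apply: (leq_trans (size_polyMleq _ _)); rewrite (leq_trans (leq_pred _)) //.
  by rewrite leq_add // ffunE size_poly.
have := E i t; rewrite h coef0 pair_big /= => e0; rewrite [RHS]e0.
by apply: eq_bigr => -[j e] _.
Qed.

Lemma poly_of_coefs_surj (v : {ffun J -> {poly A}}) :
  (forall j, size (v j) <= n.+1)%N -> exists w, v = poly_of_coefs w.
Proof.
move=> hv; exists [ffun p : J * 'I_n.+1 => (v p.1)`_p.2]; apply/ffunP => j; rewrite ffunE.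
apply/polyP => e; rewrite coef_poly; case: ltnP => he; last first.
  by rewrite nth_default // (leq_trans (hv j)).
by rewrite ffunE /= inordK.
Qed.

Lemma poly_of_coefs_submodule (N : set {ffun J -> {poly A}}) :
  submodule_set N -> submodule_set [set w | N (poly_of_coefs w)].
Proof.
move=> [N0 ND NZ]; split=> [|x y|a x] /=.
- suff -> : poly_of_coefs 0 = 0 by [].
  by apply/ffunP => j; rewrite !ffunE; apply/polyP => e; rewrite coef_poly ffunE coef0 if_same.
- move=> hx hy; suff -> : poly_of_coefs (x + y) = poly_of_coefs x + poly_of_coefs y by exact: ND.
  apply/ffunP => j; rewrite !ffunE; apply/polyP => e.
  by rewrite coefD !coef_poly ffunE; case: ifP => // _; rewrite addr0.
- move=> hx; suff -> : poly_of_coefs (ffun_scale a x) = ffun_scale a%:P (poly_of_coefs x) by exact: NZ.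
  apply/ffunP => j; rewrite !ffunE; apply/polyP => e.
  rewrite coefCM !coef_poly ffunE.
  by case: ifP => // _; rewrite mulr0.
Qed.

End Truncated.

(* Columns of [K] lie in the kernel, and division by the monic [d] reduces a
   kernel vector modulo them to one of bounded degree, hence to a solution of a
   linear system over [A]. *)
Lemma kernel_gens_monic (n : nat) (M : I -> J -> {poly A}) (d : {poly A})
    (K : J -> J -> {poly A}) s :
  d \is monic -> (forall i j, size (M i j) <= n.+1)%N ->
  (forall i j, size (K i j) <= n.+1)%N ->
  (forall i j, \sum_k M i k * K k j = 0) ->
  (forall v, in_kernel M v -> forall j, \sum_k K j k * v k = d * v j) ->
  kernel_gens (@coef_system n M) s ->
  kernel_gens M ([seq [ffun i => K i j] | j <- enum J] ++
                 [seq poly_of_coefs w | w <- s]).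
Proof.
move=> dm Ms Ks MK Kv [sker sgen]; split=> [v|N Nsub hN v vker].
  rewrite mem_cat => /orP[/mapP[j _ ->] i|/mapP[w ws ->]].
    by rewrite -[RHS](MK i j); apply: eq_bigr => l _; rewrite ffunE.
  by apply/coef_systemP => //; exact: sker.
pose q j := Pdiv.Ring.rdivp (v j) d; pose r j := Pdiv.Ring.rmodp (v j) d.
have vqr j : v j = q j * d + r j by exact: Pdiv.RingMonic.rdivp_eq.
pose v' := v - \sum_j ffun_scale (q j) [ffun i => K i j].
have v'E i : v' i = v i - \sum_j q j * K i j.
  by rewrite !ffunE sum_ffunE; congr (_ - _); apply: eq_bigr => j _; rewrite !ffunE.
have v'ker : in_kernel M v'.
  move=> i; under eq_bigr => j _ do rewrite v'E mulrBr.
  rewrite sumrB vker sub0r; apply/eqP; rewrite oppr_eq0; apply/eqP.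
  under eq_bigr => j _ do rewrite mulr_sumr.
  rewrite exchange_big /= big1 // => k _.
  transitivity (q k * \sum_j M i j * K j k); last by rewrite MK mulr0.
  by rewrite mulr_sumr; apply: eq_bigr => j _; ring.
(* Since [K v = d v], only the remainders are left: [d v' = K r]. Each [r k] has degree below that
   of [d], so cancelling the monic [d] bounds [v'] by the degree of [K] alone. *)
have dv' j : d * v' j = \sum_k K j k * r k.
  rewrite v'E mulrBr -Kv // mulr_sumr -sumrB; apply: eq_bigr => k _.
  by rewrite vqr; ring.
have v's j : (size (v' j) <= n.+1)%N.
  have [->|v0] := eqVneq (v' j) 0; first by rewrite size_poly0.
  have : (size (d * v' j)%R <= n + (size d).-1)%N.
    rewrite dv'; apply: (leq_trans (size_sum _ _ _)); apply/bigmax_leqP => k _.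
    have [->|r0] := eqVneq (r k) 0; first by rewrite mulr0 size_poly0.
    apply: (leq_trans (size_polyMleq _ _)).
    have := Ks j k; have : (size (r k) < size d)%N.
      by rewrite Pdiv.Ring.ltn_rmodpN0 ?monic_neq0.
    by move: (size _) (size _) (size _) => a b c; lia.
  rewrite size_monicM //; have := monic_neq0 dm; rewrite -size_poly_gt0.
  by move: (size _) (size _) => a b; lia.
have -> : v = v' + \sum_j ffun_scale (q j) [ffun i => K i j] by rewrite subrK.
case: (Nsub) => N0 ND NZ; apply: ND.
  have [w ew] := poly_of_coefs_surj v's; rewrite ew.
  suff : [set w : {ffun J * 'I_n.+1 -> A} | N (poly_of_coefs w)] w by [].
  apply: sgen.
  - exact: poly_of_coefs_submodule.
  - by move=> u us; apply: hN; rewrite mem_cat map_f ?orbT.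
  - by apply/coef_systemP => //; rewrite -ew.
apply: submodule_set_sum => // j; apply: hN; rewrite mem_cat.
by apply/orP; left; apply: map_f; exact: mem_enum.
Qed.

(** Applying [g] to coordinates is semilinear: scaling by [a] becomes scaling by [g a], so
    submodules still pull back to submodules. *)
Lemma kernel_gens_automorphism (M : I -> J -> {poly A}) s
    (f g : {rmorphism {poly A} -> {poly A}}) :
  cancel f g -> cancel g f ->
  kernel_gens (fun i j => f (M i j)) s ->
  kernel_gens M [seq [ffun j => g (v j)] | v : {ffun J -> {poly A}} <- s].
Proof.
move=> fg gf [sker sgen]; split=> [v /mapP[u us ->] i|N [N0 ND NZ] hN v vker].
  rewrite -[RHS](rmorph0 g) -[X in _ = g X](sker u us i) rmorph_sum.
  by apply: eq_bigr => j _; rewrite ffunE rmorphM fg.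
have -> : v = [ffun j => g ([ffun j => f (v j)] j)].
  by apply/ffunP => j; rewrite !ffunE fg.
suff : [set v : {ffun J -> {poly A}} | N [ffun j => g (v j)]]
    [ffun j => f (v j)] by [].
apply: sgen.
- split=> [|x y hx hy|a x hx] /=.
  + suff -> : [ffun j => g ((0 : {ffun J -> {poly A}}) j)] = 0 by [].
    by apply/ffunP => j; rewrite !ffunE rmorph0.
  + suff -> : [ffun j => g ((x + y) j)] = [ffun j => g (x j)] + [ffun j => g (y j)].
      exact: ND.
    by apply/ffunP => j; rewrite !ffunE rmorphD.
  + suff -> : [ffun j => g ((ffun_scale a x) j)] = ffun_scale (g a) [ffun j => g (x j)] by exact: NZ.
    by apply/ffunP => j; rewrite !ffunE rmorphM.
- by move=> u us; apply: hN; apply: map_f.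
- move=> i; rewrite -[RHS](rmorph0 f) -[X in _ = f X](vker i) rmorph_sum.
  by apply: eq_bigr => j _; rewrite ffunE rmorphM.
Qed.

End KernelOverPoly.

(** The automorphism makes the minor [d] monic up to a unit. Then [kernel_gens_monic] trades the
    outer variable for a system over [A] whose size and degrees are still at most a fixed power of
    [X]. *)
Lemma poly_kernel_gens_poly (A : idomainType) (bd : nat -> A -> Prop) :
  degree_filtration bd -> nagata bd -> poly_kernel_gens bd ->
  poly_kernel_gens (poly_bd bd).
Proof.
move=> hbd [c hc] [h hh]; exists ((4 * c + 5) * (4 * h) + 2)%N.
move=> X X1 I J M IX JX hM.
have hbd2 := poly_bd_filtration hbd.
have [d [K [d0 dbd Kbd MK Kv]]] := cramer_kernel_fin hbd2 hM.
(* [D] bounds the degrees of [d] and [K], and [Z > D] admits the weight [D.+1]. [Y] bounds the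
   images under [s]: [Z ^ c] comes from the coefficients and [Z] from the powers of ['X]. *)
pose D := (X ^ 3)%N; pose Z := (X ^ 4)%N; pose Y := (X ^ (4 * c + 5))%N.
have XD : (#|I|.+1 * X <= D)%N by rewrite /D !expnS expn0; nia.
have DZ : (D < Z)%N by rewrite /Z /D ltn_exp2l.
have XZ : (X <= Z)%N by rewrite /Z -{1}[X]expn1 leq_exp2l.
have XY : (X <= Y)%N by rewrite /Y -{1}[X]expn1 leq_exp2l ?addnS.
have ZY : (Z ^ c + Z <= Y)%N.
  rewrite /Y expnD expnM -/Z (expnS X 4) -/Z.
  have Z0 : (0 < Z)%N by exact: leq_ltn_trans DZ.
  have : (0 < Z ^ c)%N by rewrite expn_gt0 Z0.
  move: (Z ^ c)%N => T T0.
  by apply: (@leq_trans (T * Z + T * Z)%N); [apply: leq_add; nia|nia].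
have [s [s' [[sX s'X] ss' s's slead sbd]]] :
  exists s s' : {rmorphism {poly A} -> {poly A}},
  [/\ s 'X = 'X /\ s' 'X = 'X, cancel s s', cancel s' s,
      forall a, a != 0 -> bd D a -> lead_unit_deg (1 * D.+1) 0 (s a%:P) &
      forall a, bd Z a -> poly_bd bd (Z ^ c)%N (s a%:P)].
  by apply: hc; rewrite ?mul1n //; [exact: leq_trans XZ|exact: ltnW].
have sY f : poly_bd bd Z f -> poly_bd bd Y (s f).
  move=> [fZ fbd]; rewrite poly_rmorphE; apply: (bd_sum hbd2) => j _.
  apply: (bd_le hbd2 ZY); apply: (bdM hbd2); first exact: sbd.
  apply: (@bd_le _ _ hbd2 j); first by rewrite -ltnS (leq_trans (ltn_ord j)).
  by rewrite sX; exact: poly_bdXn.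
(* As [s] fixes ['X], the image of [d] is a sum of terms [s (d_j) 'X^j] with [j <= D], and
   [lead_unit_sum] applies with [L = 'X] and [w = 1]. *)
have su : lead_coef (s d) \is a GRing.unit.
  case: dbd => dD dbd; rewrite poly_rmorphE (polySpred d0) sX.
  have := @lead_unit_sum _ 1 D (fun j => s (d`_j)%:P) 'X (size d).-1.
  case=> //; rewrite ?monicX ?size_polyX //.
  - move=> j; have [->|dj] := eqVneq d`_j 0; first by left; rewrite !rmorph0.
    by right; apply: slead => //; apply: (bd_le hbd XD).
  - by rewrite -ltnS -(polySpred d0) (leq_trans dD).
  - have : d`_(size d).-1 != 0 by rewrite -lead_coefE lead_coef_eq0.
    by move=> h0; have [] := slead _ h0 (bd_le hbd XD (dbd _)).
pose u := (lead_coef (s d))^-1.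
have u0 : u != 0 by rewrite invr_eq0; apply: contraTneq su => ->; rewrite unitr0.
have MY i j : poly_bd bd Y (s (M i j)) by apply: sY; exact: (bd_le hbd2 XZ).
have KY i j : poly_bd bd Y (s (K i j)).
  by apply: sY; apply: (bd_le hbd2 _ (Kbd i j)); exact: leq_trans XD (ltnW DZ).
have Y1 : (1 < Y)%N by exact: leq_trans XY.
(* Passing to coefficients multiplies the number of equations or unknowns by at most
   [Y.+1 + Y.+1]. *)
have Y4 m : (m <= X)%N -> (m * (Y.+1 + Y.+1) <= Y ^ 4)%N.
  move=> mX; rewrite expnS leq_mul //; first exact: leq_trans mX XY.
  by rewrite !expnS expn0; move: (Y) Y1 => y y1; nia.
have [//|||i j|t tX tgen] := hh (Y ^ 4)%N _ _ _ (@coef_system A I J Y (fun i j => s (M i j))).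
- by rewrite (leq_trans Y1) // -{1}[Y]expn1 leq_exp2l.
- by rewrite card_prod card_ord Y4.
- rewrite card_prod card_ord; apply: leq_trans (Y4 _ JX).
  by rewrite leq_mul2l leq_addr orbT.
- rewrite /coef_system; case: ifP => _; last exact: (bd0 hbd).
  apply: (@bd_le _ _ hbd Y); first by rewrite -{1}[Y]expn1 leq_exp2l.
  by case: (MY i.1 j.1).
have := @kernel_gens_monic A I J Y (fun i j => s (M i j)) (u%:P * s d)
  (fun i j => u%:P * s (K i j)) t.
case=> //.
- by rewrite monicE lead_coefM lead_coefC mulVr.
- by move=> i j; case: (MY i j).
- by move=> i j; rewrite mul_polyC size_scale //; case: (KY i j).
- move=> i j; transitivity (u%:P * s (\sum_k M i k * K k j)); last first.
    by rewrite MK rmorph0 mulr0.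
  by rewrite rmorph_sum mulr_sumr; apply: eq_bigr => k _; rewrite rmorphM; ring.
- move=> v vker j.
  have /Kv/(_ j)/(congr1 s) : in_kernel M (s' \o v).
    move=> i; rewrite -[RHS](rmorph0 s') -[X in _ = s' X](vker i) rmorph_sum.
    by apply: eq_bigr => k _; rewrite rmorphM ss'.
  rewrite rmorphM /= s's -mulrA => <-; rewrite rmorph_sum mulr_sumr.
  by apply: eq_bigr => k _; rewrite rmorphM /= s's; ring.
move=> gker ggen.
eexists; last exact: (kernel_gens_automorphism ss' s's (conj gker ggen)).
rewrite size_map size_cat size_map [X in (_ + X)%N]size_map -cardT.
(* At most [X] columns of [K] join the generators of the smaller system; the [+ 2] in the exponent
   pays for this sum. *)
apply: (@leq_trans (X + (Y ^ 4) ^ h)%N); first exact: leq_add.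
rewrite -[((Y ^ 4) ^ h)%N]expnM /Y -expnM expnD.
have : (0 < X ^ ((4 * c + 5) * (4 * h)))%N by rewrite expn_gt0; lia.
move: (X ^ _)%N => T; rewrite !expnS expn0; nia.
Qed.

(** * Iterated polynomial rings *)

Fixpoint mvpoly (k : idomainType) (n : nat) : idomainType :=
  if n is m.+1 then {poly mvpoly k m} else k.

Fixpoint mvpoly_bd (k : idomainType) (n : nat) : nat -> mvpoly k n -> Prop :=
  if n is m.+1 then poly_bd (@mvpoly_bd k m) else fun _ _ => True.

Lemma mvpoly_bd_filtration (k : idomainType) n : degree_filtration (@mvpoly_bd k n).
Proof. by elim: n => //= n; exact: poly_bd_filtration. Qed.

Lemma mvpoly_bd_ex (k : idomainType) n (f : mvpoly k n) : exists D, mvpoly_bd D f.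
Proof.
elim: n f => [|n IH] /= f; first by exists 0%N.
have [D hD] : exists D, forall i, (i < size f)%N -> mvpoly_bd D f`_i.
  elim: (size f) => [|m [D hD]]; first by exists 0%N.
  have [E hE] := IH f`_m; exists (D + E)%N => i; rewrite ltnS leq_eqVlt.
  case/orP => [/eqP->|/hD h].
    by apply: (bd_le (mvpoly_bd_filtration k n) _ hE); rewrite leq_addl.
  by apply: (bd_le (mvpoly_bd_filtration k n) _ h); rewrite leq_addr.
exists (D + size f)%N; split; first by rewrite leqW // leq_addl.
move=> i; have [h|h] := ltnP i (size f).
  by apply: (bd_le (mvpoly_bd_filtration k n) _ (hD i h)); rewrite leq_addr.
by rewrite nth_default //; exact: (bd0 (mvpoly_bd_filtration k n)).
Qed.

Lemma poly_kernel_gens_mvpoly (k : fieldType) n : poly_kernel_gens (@mvpoly_bd k n).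
Proof.
suff [] : nagata (@mvpoly_bd k n) /\ poly_kernel_gens (@mvpoly_bd k n) by [].
have hbd := @mvpoly_bd_filtration k.
elim: n => [|n [h1 h2]] /=.
  by split; [exact: nagata_field|exact: poly_kernel_gens_field].
by split; [exact: nagata_poly|exact: poly_kernel_gens_poly].
Qed.

(** * The Hilbert basis theorem *)

Section Ideals.
Variable A : comPzRingType.
Implicit Types (H J : set A).

Lemma is_ideal_span H : is_ideal (ideal_span H).
Proof.
split=> [J [[]] //|x y hx hy J HJ|a x hx J HJ].
  by case: (HJ) => -[_ JD _] _; apply: JD; [exact: hx|exact: hy].
by case: (HJ) => -[_ _ JM] _; apply: JM; exact: hx.
Qed.

Lemma sub_ideal_span H : H `<=` ideal_span H.
Proof. by move=> x Hx J [_]; exact. Qed.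

Lemma ideal_span_min H J : is_ideal J -> H `<=` J -> ideal_span H `<=` J.
Proof. by move=> hJ HJ x; apply; split. Qed.

Lemma ideal_span_le H H' : H `<=` H' -> ideal_span H `<=` ideal_span H'.
Proof.
move=> h; apply: ideal_span_min; first exact: is_ideal_span.
exact: subset_trans h (@sub_ideal_span _).
Qed.

Lemma is_ideal_sum J (L : Type) (r : seq L) (P : pred L) (f : L -> A) :
  is_ideal J -> (forall i, P i -> J (f i)) -> J (\sum_(i <- r | P i) f i).
Proof. by move=> [J0 JD _] h; apply: big_ind. Qed.

Lemma is_ideal0 J : is_ideal J -> J 0.
Proof. by case. Qed.

Lemma is_idealD J x y : is_ideal J -> J x -> J y -> J (x + y).
Proof. by move=> [_ + _]; exact. Qed.

Lemma is_idealM J c x : is_ideal J -> J x -> J (c * x).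
Proof. by move=> [_ _]; exact. Qed.

Lemma is_idealB J x y : is_ideal J -> J x -> J y -> J (x - y).
Proof. by move=> [_ JD JM] Jx Jy; rewrite -mulN1r; apply: JD => //; exact: JM. Qed.

Lemma ideal_span_finite H x : ideal_span H x ->
  exists s : seq A, (forall y, y \in s -> H y) /\ ideal_span [set` s] x.
Proof.
move: x; apply: ideal_span_min; last first.
  move=> x Hx; exists [:: x]; split=> [y|]; first by rewrite inE => /eqP->.
  by apply: sub_ideal_span; rewrite /= inE.
split.
- by exists [::]; split=> //; case: (is_ideal_span [set` [::]]).
- move=> x y [s [sH sx]] [t [tH ty]]; exists (s ++ t); split.
    by move=> z; rewrite mem_cat => /orP[/sH|/tH].
  case: (is_ideal_span [set` s ++ t]) => _ D _; apply: D.
    by apply: ideal_span_le sx => z /= zs; rewrite mem_cat zs.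
  by apply: ideal_span_le ty => z /= zs; rewrite mem_cat zs orbT.
- move=> a x [s [sH sx]]; exists s; split=> //.
  by case: (is_ideal_span [set` s]) => _ _; exact.
Qed.

Lemma ideal_span_finite_seq H (l : seq A) : (forall x, x \in l -> ideal_span H x) ->
  exists s : seq A, (forall y, y \in s -> H y) /\
    forall x, x \in l -> ideal_span [set` s] x.
Proof.
elim: l => [|x l IH] hl; first by exists [::].
have [|s [sH sl]] := IH; first by move=> y yl; apply: hl; rewrite inE yl orbT.
have [t [tH tx]] := ideal_span_finite (hl x (mem_head _ _)).
exists (s ++ t); split=> [y|y]; first by rewrite mem_cat => /orP[/sH|/tH].
rewrite inE => /orP[/eqP->|/sl].
  by apply: ideal_span_le tx => z /= zs; rewrite mem_cat zs orbT.
by apply: ideal_span_le => z /= zs; rewrite mem_cat zs.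
Qed.

(** Generators are asked for inside an arbitrary set [H], not only an ideal: this later extracts
    finitely many denominators from a set of them. *)
Definition noetherian : Prop := forall H, exists s : seq A,
  (forall x, x \in s -> H x) /\ H `<=` ideal_span [set` s].

Lemma noetherian_ideal J : noetherian -> is_ideal J ->
  exists s : seq A, J = ideal_span [set` s].
Proof.
move=> hA hJ; have [s [sJ Js]] := hA J; exists s; apply/seteqP; split=> //.
exact: ideal_span_min.
Qed.

End Ideals.

Lemma noetherian_field (k : fieldType) : noetherian k.
Proof.
move=> H; have [[x Hx x0]|h] := pselect (exists2 x, H x & x != 0).
  exists [:: x]; split=> [y|y _]; first by rewrite inE => /eqP->.
  case: (is_ideal_span [set` [:: x]]) => _ _ M.
  have -> : y = (y / x) * x by rewrite divfK.
  by apply: M; apply: sub_ideal_span; rewrite /= inE.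
exists [::]; split=> // y Hy; have [->|y0] := eqVneq y 0; last by case: h; exists y.
by case: (is_ideal_span (A := k) [set` [::]]).
Qed.

(** Hilbert's argument: each [f n] has least degree outside the ideal of the earlier ones. The
    leading coefficients are generated by finitely many of them, so some [f N] can be lowered in
    degree, against minimality. *)
Lemma noetherian_poly (A : comNzRingType) : noetherian A -> noetherian {poly A}.
Proof.
move=> hA H; apply: contrapT => hH.
pose J := ideal_span H.
have min_out (l : seq {poly A}) : (forall f, f \in l -> J f) -> exists f,
    [/\ J f, ~ ideal_span [set` l] f &
     forall g, J g -> ~ ideal_span [set` l] g -> (size f <= size g)%N].
  (* If [J] were inside the ideal of [l], the finitely many elements of [H] that express [l] would
     generate all of [H]. *)
  move=> lJ; have [s [sH sl]] := ideal_span_finite_seq lJ.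
  have [f Jf lf] : exists2 f, J f & ~ ideal_span [set` l] f.
    apply: contrapT => h; apply: hH; exists s; split=> // x Hx.
    have lx : ideal_span [set` l] x.
      by apply: contrapT => lx; apply: h; exists x => //; exact: sub_ideal_span.
    by move: x lx {Hx}; apply: ideal_span_min; [exact: is_ideal_span|exact: sl].
  pose p m := `[< exists f, [/\ J f, ~ ideal_span [set` l] f & size f = m] >].
  have pex : exists m, p m by exists (size f); apply/asboolP; exists f.
  case: (ex_minnP pex) => m /asboolP[f0 [Jf0 lf0 sf0]] mmin; exists f0; split=> //.
  by move=> g Jg lg; rewrite sf0; apply: mmin; apply/asboolP; exists g.
have /choice[F hF] : forall l : seq {poly A}, exists f, (forall f, f \in l -> J f) ->
    [/\ J f, ~ ideal_span [set` l] f &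
     forall g, J g -> ~ ideal_span [set` l] g -> (size f <= size g)%N].
  move=> l.
  have [/min_out[f hf]|h] := pselect (forall f, f \in l -> J f); first by exists f.
  by exists 0.
pose l n := iter n (fun l => F l :: l) [::].
have lJ n f : f \in l n -> J f.
  elim: n f => //= n IH f; rewrite inE => /orP[/eqP->|]; last exact: IH.
  by case: (hF (l n) IH).
pose f n := F (l n).
have fl i n : (i < n)%N -> f i \in l n.
  elim: n => //= n IH; rewrite ltnS leq_eqVlt inE => /orP[/eqP->|/IH->].
    by rewrite eqxx.
  by rewrite orbT.
have lle i n : (i <= n)%N -> [set` l i] `<=` [set` l n].
  move=> /subnK<-; elim: (n - i)%N => //= m IH x xl.
  by rewrite /= inE; apply/orP; right; exact: IH.
have fle i n : (i <= n)%N -> (size (f i) <= size (f n))%N.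
  move=> ile; have [_ _ h] := hF _ (@lJ i); have [Jf nf _] := hF _ (@lJ n).
  by apply: h => // h'; apply: nf; apply: ideal_span_le h'; exact: lle.
have [s [sa ale]] := hA (range (fun n => lead_coef (f n))).
have [N hN] : exists N, forall x, x \in s -> exists2 i, (i < N)%N & x = lead_coef (f i).
  elim: s sa {ale} => [|x s IH] sa; first by exists 0%N.
  have [|N hN] := IH; first by move=> y ys; apply: sa; rewrite inE ys orbT.
  have [i _ ix] := sa x (mem_head _ _).
  exists (N + i.+1)%N => y; rewrite inE => /orP[/eqP->|/hN[j jN ->]].
    by exists i; rewrite // addnS ltnS leq_addl.
  by exists j; rewrite // ltn_addr.
have [JfN nfN minN] := hF _ (@lJ N); rewrite -/(f N) in JfN nfN minN.
have [lN0 lND lNM] := is_ideal_span [set` l N].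
have fN0 : f N != 0 by apply/eqP => e; apply: nfN; rewrite e.
pose d := (size (f N)).-1.
(* Shifting the earlier [f i] to degree [d] puts their leading coefficients into the ideal [T],
   hence also that of [f N]. *)
pose T : set A := [set a | exists2 g, ideal_span [set` l N] g & (size g <= d.+1)%N /\ g`_d = a].
have : T (lead_coef (f N)).
  have : ideal_span [set` s] (lead_coef (f N)) by apply: ale; exists N.
  move: (lead_coef (f N)); apply: ideal_span_min.
    split.
    - by exists 0 => //; rewrite size_poly0 coef0.
    - move=> _ _ [g lg [sg <-]] [g' lg' [sg' <-]]; exists (g + g'); first exact: lND.
      by rewrite coefD (leq_trans (size_polyD _ _)) // geq_max sg.
    - move=> a _ [g lg [sg <-]]; exists (a%:P * g); first exact: lNM.
      by rewrite coefCM mul_polyC (leq_trans (size_scale_leq _ _)).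
  move=> x /= /hN[i iN ->]; exists ('X^(d - (size (f i)).-1) * f i).
    by apply: lNM; apply: sub_ideal_span; exact: fl.
  have := fle i N (ltnW iN); have := polySpred fN0; rewrite -/d => -> fi.
  have fid : ((size (f i)).-1 <= d)%N by lia.
  rewrite coefXnM ltnNge leq_subr /= subKn //; split=> //.
  rewrite (leq_trans (size_polyMleq _ _)) // size_polyXn.
  by move: (size (f i)) fi fid => a; lia.
move=> [g lg [sg eg]].
have : (size (f N) <= size (f N - g)%R)%N.
  apply: minN.
    apply: (is_idealB (is_ideal_span H)) => //.
    by move: g lg {sg eg}; apply: ideal_span_min; [exact: is_ideal_span|exact: lJ].
  by move=> h; apply: nfN; rewrite -(subrK g (f N)); exact: lND.
rewrite (polySpred fN0) -/d; apply/negP; rewrite -leqNgt.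
apply/leq_sizeP => j; rewrite leq_eqVlt => /orP[/eqP<-|dj].
  by rewrite coefB eg lead_coefE subrr.
by rewrite coefB !nth_default ?subrr // ?(leq_trans sg) // (polySpred fN0).
Qed.

Lemma noetherian_mvpoly (k : idomainType) n : noetherian k -> noetherian (mvpoly k n).
Proof. by move=> hk; elim: n => //= n; exact: noetherian_poly. Qed.

(** The last clause is an induction principle for the image, replacing an explicit formula for
    evaluation. *)
Lemma mvpoly_eval (A : idomainType) (B : comNzRingType) (f : {rmorphism A -> B})
    (b : nat -> B) n : exists g : {rmorphism mvpoly A n -> B},
  [/\ forall a, exists x, g x = f a, forall i, (i < n)%N -> exists x, g x = b i &
      forall P : set B, (forall x y, P x -> P y -> P (x + y)) ->
        (forall x y, P x -> P y -> P (x * y)) -> (forall a, P (f a)) ->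
        (forall i, (i < n)%N -> P (b i)) -> forall x, P (g x)].
Proof.
elim: n => [|n [g [gf gb gP]]] /=; first by exists f; split=> // a; exists a.
have [h [hC hX]] := poly_ext g (b n); exists h; split.
- by move=> a; have [x <-] := gf a; exists x%:P.
- move=> i; rewrite ltnS leq_eqVlt => /orP[/eqP->|/gb[x <-]]; last by exists x%:P.
  by exists 'X.
- move=> P PD PM Pf Pb x; rewrite poly_rmorphE hX.
  apply: (big_ind P) => //; first by rewrite -(rmorph0 f).
  move=> i _; apply: (PM); first by rewrite hC; exact: (gP P PD PM Pf (fun j jn => Pb j (leqW jn))).
  elim: (val i) => [|m IH]; first by rewrite expr0 -(rmorph1 f).
  by rewrite exprS; apply: PM => //; exact: Pb.
Qed.

(** * Symbolic powers as conductors *)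

Section IdealPowers.
Variable A : comPzRingType.
Implicit Types I J : set A.

Lemma is_ideal_pow I n : is_ideal (ideal_pow I n).
Proof. by case: n => [|n] //=; exact: is_ideal_span. Qed.

Lemma ideal_powM I m n x y :
  ideal_pow I m x -> ideal_pow I n y -> ideal_pow I (m + n) (x * y).
Proof.
elim: m x y => [|m IH] x y.
  by case: (is_ideal_pow I n) => _ _ M _ hy; exact: M.
have [P0 PD PM] := is_ideal_pow I (m.+1 + n).
move=> + hy; move: x; apply: ideal_span_min.
  split=> [|u v hu hv|a u hu] /=; rewrite ?mul0r ?mulrDl -?mulrA //.
  - exact: PD.
  - exact: PM.
move=> _ [u Iu [v hv <-]] /=; rewrite -mulrA; apply: sub_ideal_span.
by exists u => //; exists (v * y) => //; exact: IH.
Qed.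

Lemma ideal_pow_decr I m n : (m <= n)%N -> ideal_pow I n `<=` ideal_pow I m.
Proof.
move=> /subnK<-; elim: (n - m)%N => //= k IH; apply: ideal_span_min.
  exact: is_ideal_pow.
move=> _ [u _ [v hv <-]]; case: (is_ideal_pow I m) => _ _ M.
by apply: M; exact: IH.
Qed.

Definition ideal_add I J : set A := [set x + y | x in I & y in J].

Lemma is_ideal_add I J : is_ideal I -> is_ideal J -> is_ideal (ideal_add I J).
Proof.
move=> [I0 ID IM] [J0 JD JM]; split.
- by exists 0 => //; exists 0 => //; rewrite addr0.
- move=> _ _ [x Ix [y Jy <-]] [x' Ix' [y' Jy' <-]].
  exists (x + x'); first exact: ID.
  by exists (y + y'); [exact: JD|ring].
- move=> a _ [x Ix [y Jy <-]]; exists (a * x); first exact: IM.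
  by exists (a * y); [exact: JM|rewrite mulrDr].
Qed.

Lemma ideal_addl I J : is_ideal J -> I `<=` ideal_add I J.
Proof. by move=> [J0 _ _] x Ix; exists x => //; exists 0; rewrite ?addr0. Qed.

Lemma ideal_addr I J : is_ideal I -> J `<=` ideal_add I J.
Proof. by move=> [I0 _ _] x Jx; exists 0 => //; exists x; rewrite ?add0r. Qed.

End IdealPowers.

(** * Rees algebra and uniform denominators *)

Section Rees.
Variables (S : idomainType) (g : seq S) (a : set S).
Hypothesis hS : forall m, noetherian (mvpoly S m).
Hypothesis ha : is_ideal a.

Local Notation G := (ideal_pow (ideal_span [set` g])).

Definition pow_add (n : nat) : set S := ideal_add (G n) a.
Local Notation Q := pow_add.

Lemma is_ideal_pow_add n : is_ideal (Q n).
Proof. by apply: is_ideal_add => //; exact: is_ideal_pow. Qed.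

Lemma pow_add_decr m n : (m <= n)%N -> Q n `<=` Q m.
Proof.
move=> mn _ [x Gx [y ay <-]]; exists x; last by exists y.
exact: (ideal_pow_decr mn).
Qed.

Lemma pow_addM m n x y : G m x -> Q n y -> Q (m + n) (x * y).
Proof.
move=> Gx [u Gu [v av <-]]; rewrite mulrDr; exists (x * u); first exact: ideal_powM.
by exists (x * v) => //; case: ha => _ _; exact.
Qed.

(* The map [S[X_1, ..., X_m] -> S[t]], [X_i |-> g_i t], whose image is the Rees
   algebra of the ideal generated by [g]. *)
Lemma rees_map : exists psi : {rmorphism mvpoly S (size g) -> {poly S}},
  (forall F i, G i (psi F)`_i) /\
  forall n f, G n f -> exists F, psi F = f%:P * 'X^n.
Proof.
have [psi [psiC psiX psiP]] := mvpoly_eval polyC (fun i => (g`_i)%:P * 'X) (size g).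
exists psi; split=> [F|n].
  apply: (psiP (fun p => forall i, G i p`_i)) => [x y hx hy i|x y hx hy i|s i|j jg i].
  - by rewrite coefD; case: (is_ideal_pow (ideal_span [set` g]) i) => _ + _; exact.
  - rewrite coefM; apply: is_ideal_sum; first exact: is_ideal_pow.
    move=> j _; have := ideal_powM (hx j) (hy (i - j)%N).
    by rewrite subnKC // -ltnS.
  - by case: i => [|i] //; rewrite coefC; case: (is_ideal_pow (ideal_span [set` g]) i.+1).
  - rewrite coefCM coefX; case: i => [|[|i]] //=.
    + by apply: sub_ideal_span; exists g`_j; [apply: sub_ideal_span; exact: mem_nth|exists 1].
    + by rewrite mulr0; exact: (is_ideal0 (is_ideal_span _)).
elim: n => [|n IH] f.
  by move=> _; have [F <-] := psiC f; exists F; rewrite expr0 mulr1.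
move: f; change (G n.+1 `<=` [set f : S | exists F, psi F = f%:P * 'X^(n.+1)]).
apply: ideal_span_min.
  split.
  - by exists 0; rewrite !rmorph0 mul0r.
  - by move=> x y [F eF] [F' eF']; exists (F + F'); rewrite !rmorphD mulrDl eF eF'.
  - move=> c x [F eF]; have [C eC] := psiC c.
    by exists (C * F); rewrite !rmorphM eF eC mulrA.
move=> _ [x xg [y /IH[F eF] <-]] /=.
have [U eU] : exists U, psi U = x%:P * 'X.
  move: x xg; change (ideal_span [set` g] `<=` [set x : S | exists U, psi U = x%:P * 'X]).
  apply: ideal_span_min.
    split.
    - by exists 0; rewrite !rmorph0 mul0r.
    - by move=> x z [U eU] [V eV]; exists (U + V); rewrite !rmorphD mulrDl eU eV.
    - move=> c x [U eU]; have [C eC] := psiC c.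
      by exists (C * U); rewrite !rmorphM eU eC mulrA.
  by move=> _ /(nthP 0)[i ig <-]; exact: psiX.
by exists (U * F); rewrite !rmorphM eU eF exprS; ring.
Qed.

(* The [F] in the Rees algebra whose components become zero in the associated
   graded ring after multiplication by an element of [W] form an ideal; a single
   [h] in [W] works for its finitely many generators, hence for all of it. *)
Lemma uniform_denominator (W : mult_set S) : exists2 h, (W : set S) h &
  forall n f, (exists2 s, (W : set S) s & Q n (s * f)) -> Q n (h ^+ n * f).
Proof.
have [psi [psi_coef psi_lift]] := rees_map.
(* [T h] holds the [F] whose component of each degree [i] is killed by [h] in [Q i / Q i.+1]. *)
pose T h := [set F | forall i, Q i.+1 (h * (psi F)`_i)].
have hT h : is_ideal (T h).
  split.
  - by move=> i; rewrite rmorph0 coef0 mulr0; exact: (is_ideal0 (is_ideal_pow_add i.+1)).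
  - move=> x y hx hy i; rewrite rmorphD coefD mulrDr.
    by case: (is_ideal_pow_add i.+1) => _ + _; apply.
  - move=> c x hx i; rewrite rmorphM coefM mulr_sumr.
    apply: is_ideal_sum; first exact: is_ideal_pow_add.
    move=> j _; rewrite mulrCA.
    have := pow_addM (psi_coef c j) (hx (i - j)%N).
    by rewrite addnS subnKC // -ltnS.
have TM h h' F : T h F -> T (h' * h) F.
  move=> hF i; rewrite -mulrA.
  by case: (is_ideal_pow_add i.+1) => _ _; apply.
have [s [sT Ts]] := hS [set F | exists2 h, (W : set S) h & T h F].
have [h Wh hs] : exists2 h, (W : set S) h & forall F, F \in s -> T h F.
  elim: s sT {Ts} => [|F s IH] sT; first by exists 1 => //; exact: mult_carrier1.
  have [|h Wh hs] := IH; first by move=> x xs; apply: sT; rewrite inE xs orbT.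
  have [h' Wh' hF] := sT F (mem_head _ _).
  exists (h * h'); first exact: mult_carrierM.
  move=> x; rewrite inE => /orP[/eqP->|/hs]; first exact: TM.
  by rewrite mulrC; exact: TM.
have hall F : (exists2 h, (W : set S) h & T h F) -> T h F.
  by move=> /Ts; move: F; apply: ideal_span_min.
exists h => // n f [t Wt tf].
(* To climb one step, [h ^+ i * f] is split as [q + x] with [x] in [a], and [q] is lifted to degree
   [i] of the Rees algebra; membership of the lift in [T h] puts [h * q] into [Q i.+1]. *)
suff main i : (i <= n)%N -> Q i (h ^+ i * f) by exact: main.
elim: i => [_|i IH iln].
  by apply: ideal_addl.
have [q Gq [x ax e]] := IH (ltnW iln).
have [F eF] := psi_lift i q Gq.
have : T h F.
  apply: hall; exists t => // j; rewrite eF coefMXn.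
  have [ji|ij|->] := ltngtP j i; last first.
  - rewrite coefC subnn /=.
    (* [t * q = h ^+ i * (t * f) - t * x] lies in [Q i.+1] because [t * f] is in [Q n] and
       [i < n]. *)
    have -> : q = h ^+ i * f - x by rewrite -e addrK.
    rewrite mulrBr; apply: is_idealB; first exact: is_ideal_pow_add.
      apply: (pow_add_decr iln); rewrite mulrCA.
      by case: (is_ideal_pow_add n) => _ _; apply.
    apply: ideal_addr; first exact: is_ideal_pow.
    by case: ha => _ _; apply.
  - rewrite coefC subn_eq0 leqNgt ij /= mulr0; exact: (is_ideal0 (is_ideal_pow_add j.+1)).
  - rewrite mulr0; exact: (is_ideal0 (is_ideal_pow_add j.+1)).
move=> /(_ i); rewrite eF coefMXn ltnn subnn coefC /= => hq.
rewrite exprS -mulrA -e mulrDr.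
case: (is_ideal_pow_add i.+1) => _ QD _; apply: QD => //.
apply: ideal_addr; first exact: is_ideal_pow.
by case: ha => _ _; apply.
Qed.

Lemma prime_ideal_exp (A : comPzRingType) (P : prime_ideal A) x n :
  (P : set A) (x ^+ n) -> (P : set A) x.
Proof.
case: (prime_setP P) => [[P0 _ _] P1 PM].
by elim: n => [|n IH]; rewrite ?expr0 // exprS => /PM[].
Qed.

(** The uniform denominators of all [P] in [PP], possibly infinitely many, lie in the ideal of
    finitely many of them. A prime [P] without a witness would contain every [h] in [hs], hence its
    own denominator, which lies outside [P]. *)
Lemma saturation_finite (PP : set (prime_ideal S)) : exists hs : seq S,
  forall n f, (forall P, PP P -> exists2 s, ~ (P : set S) s & Q n (s * f)) <->
              (forall h, h \in hs -> Q n (h ^+ n * f)).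
Proof.
pose H := [set h | exists P, [/\ PP P, ~ (P : set S) h &
  forall n f, (exists2 s, ~ (P : set S) s & Q n (s * f)) -> Q n (h ^+ n * f)]].
have noeS : noetherian S by exact: (@hS 0%N).
have [hs [hsH Hhs]] := noeS H.
exists hs => n f; split=> [hf h /hsH[P [PPP _ hP]]|hf P PPP].
  by apply: hP; exact: hf.
apply: contrapT => no.
have [h Ph hP] := uniform_denominator (prime_compl P).
have Hh : H h by exists P; split=> //.
have [PI P1 PM] := prime_setP P.
have hh := Hhs h Hh; apply: Ph; clear hP Hh; move: h hh.
apply: ideal_span_min => // h /hf Qh.
apply: contrapT => Ph; apply: no; exists (h ^+ n) => //.
by move=> /prime_ideal_exp.
Qed.

End Rees.

(** * Monomial generators of ideal powers *)

Section Monomials.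
Variable A : comPzRingType.
Implicit Types (g : seq A).

Fixpoint monomials g (n : nat) : seq A :=
  if g is x :: g' then
    flatten [seq [seq x ^+ i * u | u <- monomials g' (n - i)] | i <- iota 0 n.+1]
  else if n is 0%N then [:: 1] else [::].

Lemma monomials_consP x g n u : reflect
  (exists2 i, (i <= n)%N & exists2 v, v \in monomials g (n - i) & u = x ^+ i * v)
  (u \in monomials (x :: g) n).
Proof.
apply: (iffP flatten_mapP) => [[i + /mapP[v vm ->]]|[i ilen [v vm ->]]].
  by rewrite mem_iota => /= h; exists i => //; exists v.
by exists i; [rewrite mem_iota|exact: map_f].
Qed.

Lemma size_flatten_leq (T : Type) (ss : seq (seq T)) b :
  all (fun s => size s <= b)%N ss -> (size (flatten ss) <= size ss * b)%N.
Proof.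
by elim: ss => //= s ss IH /andP[h /IH]; rewrite size_cat mulSn; exact: leq_add.
Qed.

(** Each of the [size g] exponents takes at most [n.+1] values. *)
Lemma size_monomials g n : (size (monomials g n) <= n.+1 ^ size g)%N.
Proof.
elim: g n => [|x g IH] n; first by case: n.
have -> : monomials (x :: g) n =
  flatten [seq [seq x ^+ i * u | u <- monomials g (n - i)] | i <- iota 0 n.+1] by [].
rewrite expnS.
apply: (leq_trans (@size_flatten_leq _ _ (n.+1 ^ size g)%N _)); last first.
  by rewrite size_map size_iota.
apply/allP => _ /mapP[i _ ->]; rewrite size_map; apply: (leq_trans (IH _)).
by case: (size g) => // m; rewrite leq_exp2r // ltnS leq_subr.
Qed.

Lemma monomials1 g : 1 \in monomials g 0.
Proof.
elim: g => [|x g IH]; first by rewrite /= inE.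
by apply/monomials_consP; exists 0%N => //; exists 1; rewrite // expr0 mulr1.
Qed.

Lemma monomialsM g n y u :
  y \in g -> u \in monomials g n -> y * u \in monomials g n.+1.
Proof.
elim: g n u => // x g IH n u; rewrite inE => hy /monomials_consP[i ilen [v vm ->]].
apply/monomials_consP; case/orP: hy => [/eqP->|yg].
  by exists i.+1 => //; exists v; rewrite ?subSS // exprS mulrA.
exists i; first exact: leqW.
by exists (y * v); [rewrite subSn //; exact: IH|rewrite mulrCA].
Qed.

Lemma ideal_pow_exp (I : set A) x n : I x -> ideal_pow I n (x ^+ n).
Proof.
move=> Ix; elim: n => [|n IH] //=.
by apply: sub_ideal_span; exists x => //; exists (x ^+ n); rewrite // exprS.
Qed.

Lemma monomials_pow (I : set A) g n u :
  (forall x, x \in g -> I x) -> u \in monomials g n -> ideal_pow I n u.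
Proof.
elim: g n u => [|x g IH] n u gI; first by case: n.
move=> /monomials_consP[i ilen [v vm ->]]; rewrite -(subnKC ilen).
apply: ideal_powM; first by apply: ideal_pow_exp; exact: gI (mem_head _ _).
by apply: IH vm => y yg; apply: gI; rewrite inE yg orbT.
Qed.

Lemma ideal_pow_span_seq g n :
  ideal_pow (ideal_span [set` g]) n = ideal_span [set` monomials g n].
Proof.
apply/seteqP; split; last first.
  apply: ideal_span_min; first exact: is_ideal_pow.
  move=> u um; apply: (monomials_pow _ um) => x xg; exact: sub_ideal_span.
elim: n => [|n IH].
  move=> x _; rewrite -[x]mulr1; apply: (is_idealM _ (is_ideal_span _)).
  by apply: sub_ideal_span; exact: monomials1.
have hI := is_ideal_span [set` monomials g n.+1].
apply: ideal_span_min => // _ [x xg [y /IH ym <-]].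
(* Membership of a product is an ideal condition on each factor, so the two factors are reduced to
   generators one after the other. *)
have mid (z : A) : is_ideal [set x | ideal_span [set` monomials g n.+1] (x * z)].
  split=> [|u v hu hv|c u hu] /=.
  - by rewrite mul0r; exact: (is_ideal0 hI).
  - by rewrite mulrDl; exact: (is_idealD hI).
  - by rewrite -mulrA; exact: (is_idealM _ hI).
refine (ideal_span_min (mid y) _ xg) => z zg /=.
rewrite mulrC; refine (ideal_span_min (mid z) _ ym) => w wm /=.
by rewrite mulrC; apply: sub_ideal_span; exact: monomialsM.
Qed.

End Monomials.

Lemma bd_monomials (A : comNzRingType) (bd : nat -> A -> Prop) D (g : seq A) n u :
  degree_filtration bd -> (forall x, x \in g -> bd D x) ->
  u \in monomials g n -> bd (n * D)%N u.
Proof.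
move=> hbd; elim: g n u => [|x g IH] n u gD.
  case: n => [|n] //=; rewrite inE => /eqP->; exact: (bd1 hbd).
move=> /monomials_consP[i ilen [v vm ->]]; rewrite -{1}(subnKC ilen) mulnDl.
apply: (bdM hbd); first by apply: (bdX hbd); exact: gD (mem_head _ _).
by apply: IH vm => y yg; apply: gD; rewrite inE yg orbT.
Qed.

Lemma ideal_add_span_seq (A : comPzRingType) (s t : seq A) :
  ideal_add (ideal_span [set` s]) (ideal_span [set` t]) = ideal_span [set` s ++ t].
Proof.
apply/seteqP; split.
  move=> _ [x hx [y hy <-]]; apply: (is_idealD (is_ideal_span _)).
    by apply: ideal_span_le hx => z /= zs; rewrite mem_cat zs.
  by apply: ideal_span_le hy => z /= zs; rewrite mem_cat zs orbT.
apply: ideal_span_min => [|x /=]; first by apply: is_ideal_add; exact: is_ideal_span.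
rewrite mem_cat => /orP[xs|xt].
  by apply: ideal_addl; [exact: is_ideal_span|exact: sub_ideal_span].
by apply: ideal_addr; [exact: is_ideal_span|exact: sub_ideal_span].
Qed.

Lemma ideal_span_seqE (A : comPzRingType) (s : seq A) x :
  ideal_span [set` s] x <-> exists u : 'I_(size s) -> A, x = \sum_i u i * s`_i.
Proof.
split; last first.
  move=> [u ->]; apply: is_ideal_sum; [exact: is_ideal_span|move=> i _].
  apply: (is_idealM _ (is_ideal_span _)).
  by apply: sub_ideal_span => /=; exact: mem_nth.
pose J := [set x | exists u : 'I_(size s) -> A, x = \sum_i u i * s`_i].
move: x; change (ideal_span [set` s] `<=` J); apply: ideal_span_min.
  split.
  - by exists (fun=> 0); rewrite big1 // => i _; rewrite mul0r.
  - move=> _ _ [u ->] [v ->]; exists (fun i => u i + v i).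
    by rewrite -big_split; apply: eq_bigr => i _; rewrite mulrDl.
  - move=> c _ [u ->]; exists (fun i => c * u i).
    by rewrite mulr_sumr; apply: eq_bigr => i _; rewrite mulrA.
move=> _ /(nthP 0)[i si <-]; exists (fun j => (j == Ordinal si)%:R).
rewrite (bigD1 (Ordinal si)) //= eqxx mul1r big1 ?addr0 // => j /negPf->.
by rewrite mul0r.
Qed.

(* [f] lies in the conductor iff it is the [None] coordinate of a kernel vector:
   the other coordinates express each [- p_i * f] on the generators [q]. *)
Section Conductor.
Variables (A : comNzRingType) (p q : seq A).

Definition conductor : set A :=
  [set f | forall h, h \in p -> ideal_span [set` q] (h * f)].

Definition conductor_matrix (i : 'I_(size p)) (j : option ('I_(size p) * 'I_(size q))) : A :=
  if j is Some (i', l) then (if i == i' then q`_l else 0) else p`_i.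

Lemma conductor_matrixE i (v : option ('I_(size p) * 'I_(size q)) -> A) :
  \sum_j conductor_matrix i j * v j =
  p`_i * v None + \sum_l v (Some (i, l)) * q`_l.
Proof.
rewrite (bigD1 None) //=; congr (_ + _).
rewrite (reindex_omap Some id) /=; last by case.
rewrite (eq_bigl xpredT); last by move=> j; rewrite eqxx.
transitivity (\sum_(i' : 'I_(size p)) \sum_(l : 'I_(size q))
    (if i == i' then q`_l else 0) * v (Some (i', l))).
  by rewrite pair_big /=; apply: eq_bigr => -[].
rewrite (bigD1 i) //= [X in _ + X]big1 ?addr0 => [|i' ii'].
  by apply: eq_bigr => l _; rewrite eqxx mulrC.
by rewrite big1 // => l _; rewrite eq_sym (negPf ii') mul0r.
Qed.

Lemma conductor_gens s : kernel_gens conductor_matrix s ->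
  conductor = ideal_span [set` [seq (v : {ffun _ -> _}) None | v <- s]].
Proof.
move=> [sker sgen]; apply/seteqP; split=> [f hf|].
  have /choice[u hu] : forall i : 'I_(size p), exists u : 'I_(size q) -> A,
      p`_i * f = \sum_l u l * q`_l.
    by move=> i; apply/ideal_span_seqE; apply: hf; exact: mem_nth.
  pose v : {ffun option ('I_(size p) * 'I_(size q)) -> A} := [ffun j : option ('I_(size p) * 'I_(size q)) =>
    if j is Some (i, l) then - u i l else f].
  have -> : f = v None by rewrite ffunE.
  (* [N] is the pullback of the ideal along the [None] coordinate, a linear map. *)
  pose N := (fun v : {ffun option ('I_(size p) * 'I_(size q)) -> A} => ideal_span [set` [seq (v : {ffun _ -> _}) None | v <- s]] (v None)).
  apply: (sgen N).
  - split=> [|x y hx hy|a x hx]; rewrite /N.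
    + by rewrite ffunE; exact: (is_ideal0 (is_ideal_span _)).
    + by rewrite ffunE; exact: (is_idealD (is_ideal_span _)).
    + by rewrite ffunE; exact: (is_idealM _ (is_ideal_span _)).
  - by move=> w ws; apply: sub_ideal_span; exact: (map_f (fun v : {ffun _ -> A} => v None)).
  - move=> i; rewrite conductor_matrixE ffunE hu -big_split big1 //= => l _.
    by rewrite ffunE mulNr addrN.
have hq := is_ideal_span [set` q].
apply: ideal_span_min.
  split=> [h _|x y hx hy h hp|a x hx h hp].
  - by rewrite mulr0; exact: (is_ideal0 hq).
  - by rewrite mulrDr; apply: (is_idealD hq); [exact: hx|exact: hy].
  - by rewrite mulrCA; apply: (is_idealM _ hq); exact: hx.
move=> _ /mapP[v /sker vker ->] _ /(nthP 0)[i ip <-].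
have /eqP := vker (Ordinal ip); rewrite conductor_matrixE addr_eq0 => /eqP->.
rewrite -mulN1r; apply: (is_idealM _ hq); apply/ideal_span_seqE.
by exists (fun l => v (Some (Ordinal ip, l))).
Qed.

End Conductor.

Lemma bd_seq (A : Type) (bd : nat -> A -> Prop) (T : eqType) (f : T -> A) (s : seq T) :
  (forall D E a, (D <= E)%N -> bd D a -> bd E a) -> (forall a, exists D, bd D a) ->
  exists D, forall x, x \in s -> bd D (f x).
Proof.
move=> hle hex; elim: s => [|x s [D hD]]; first by exists 0%N.
have [E hE] := hex (f x); exists (D + E)%N => y; rewrite inE => /orP[/eqP->|/hD h].
  by apply: hle hE; exact: leq_addl.
by apply: hle h; exact: leq_addr.
Qed.

(** Powers [h ^+ n] and monomials of degree [n] in [g] have degrees linear in [n], and these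
    monomials are polynomially many, so the kernel bound applies to the conductor matrix with [X]
    polynomial in [n]. *)
Lemma saturation_bound (k : fieldType) (d : nat) (g a : seq (mvpoly k d))
    (PP : set (prime_ideal (mvpoly k d))) : exists B e, forall n,
  exists2 s : seq (mvpoly k d), (size s <= B * n.+1 ^ e)%N &
    [set f | forall P, PP P ->
      exists2 x, ~ (P : set (mvpoly k d)) x &
        pow_add g (ideal_span [set` a]) n (x * f)] = ideal_span [set` s].
Proof.
have noe m : noetherian (mvpoly (mvpoly k d) m).
  by apply: noetherian_mvpoly; apply: noetherian_mvpoly; exact: noetherian_field.
have hbd := @mvpoly_bd_filtration k d.
have [hs hsP] := saturation_finite g noe (is_ideal_span [set` a]) PP.
have [c hc] := @poly_kernel_gens_mvpoly k d.
have [D hD] := @bd_seq _ (@mvpoly_bd k d) _ id (hs ++ g ++ a) (bd_le hbd) (@mvpoly_bd_ex k d).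
pose m := size g; pose l := size hs.
(* [l * (1 + size a) + 1] serves the columns, [l] the rows, [D] the degrees, and [2] the condition
   [1 < X]. *)
pose B := (l * (1 + size a) + 1 + l + D + 2)%N.
exists (B ^ c)%N, (m.+1 * c)%N => n.
pose p := [seq h ^+ n | h <- hs]; pose q := monomials g n ++ a.
have -> : [set f | forall P, PP P ->
      exists2 x, ~ (P : set (mvpoly k d)) x &
        pow_add g (ideal_span [set` a]) n (x * f)] = conductor p q.
  apply/seteqP; split=> f; rewrite /= /conductor /q -ideal_add_span_seq -ideal_pow_span_seq.
    by move=> /hsP hf _ /mapP[h hh ->]; exact: hf.
  by move=> hf; apply/hsP => h hh; apply: hf; exact: map_f.
(* [n.+1 ^ m] bounds the number of monomials; the further factor [n.+1] covers the degrees
   [n * D]. *)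
pose X := (B * n.+1 ^ m.+1)%N.
have Xn : (B * (n.+1 ^ m * n.+1) = X)%N by rewrite /X expnS [(n.+1 * _)%N]mulnC.
have n0 : (0 < n.+1 ^ m)%N by rewrite expn_gt0.
have [|||i j|s sX /conductor_gens es] := hc X _ _ _ (@conductor_matrix _ p q).
- by rewrite -Xn /B; move: (n.+1 ^ m)%N n0 => N; nia.
- by rewrite card_ord size_map -/l -Xn /B; move: (n.+1 ^ m)%N n0 => N; nia.
- rewrite card_option card_prod !card_ord size_map size_cat -/l.
  have := size_monomials g n; rewrite -/m -Xn /B.
  move: (n.+1 ^ m)%N n0 (size (monomials _ _)) => N N0 M MN.
  apply: (@leq_trans ((l * (1 + size a)) * N + 1 * N)%N).
    rewrite mul1n -addn1 leq_add // -mulnA leq_mul2l; apply/orP; right.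
    by rewrite mulnDl mul1n leq_add // leq_pmulr.
  by rewrite -mulnDl mulnA -[X in (X <= _)%N]muln1 leq_mul // leq_mul2r; apply/orP; right; lia.
- have nDX : (n * D <= X)%N by rewrite -Xn /B; move: (n.+1 ^ m)%N n0 => N; nia.
  have DX : (D <= X)%N by rewrite -Xn /B; move: (n.+1 ^ m)%N n0 => N; nia.
  case: j => [[i' j]|] /=.
    case: ifP => _; last exact: (bd0 hbd).
    have : q`_j \in q by exact: mem_nth.
    rewrite {1}/q mem_cat => /orP[hj|hj].
      apply: (bd_le hbd nDX); apply: bd_monomials hj => // x xg.
      by apply: hD; rewrite !mem_cat xg orbT.
    by apply: (bd_le hbd DX); apply: hD; rewrite !mem_cat hj !orbT.
  have : p`_i \in p by exact: mem_nth.
  move=> /mapP[h hh ->]; apply: (bd_le hbd nDX); apply: (bdX hbd).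
  by apply: hD; rewrite mem_cat hh.
rewrite es; eexists; last reflexivity.
by rewrite size_map (leq_trans sX) // /X expnMn expnM.
Qed.

Lemma is_ideal_preimage (A B : comPzRingType) (f : {rmorphism A -> B}) (J : set B) :
  is_ideal J -> is_ideal [set x | J (f x)].
Proof.
move=> hJ; split=> [|x y|c x] /=; rewrite ?rmorph0 ?rmorphD ?rmorphM.
- exact: is_ideal0.
- exact: is_idealD.
- exact: is_idealM.
Qed.

(** * Localizations of finitely generated algebras *)

Section SymbolicPower.
Variables (R : comPzRingType) (I : set R).

Lemma is_ideal_symbolic_power n : is_ideal (symbolic_power I n).
Proof.
have h (P : prime_ideal R) := is_ideal_preimage (loc_map (prime_compl P))
  (is_ideal_span (loc_map (prime_compl P) @` ideal_pow I n)).
split=> [P MP|x y hx hy P MP|c x hx P MP].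
- exact: (is_ideal0 (h P)).
- exact: (is_idealD (h P) (hx P MP) (hy P MP)).
- exact: (is_idealM c (h P) (hx P MP)).
Qed.

Lemma loc_map_unit (W : mult_set R) (s : set_type W) :
  loc_frac 1 s * loc_map W (val s) = 1 :> localization W.
Proof.
change (loc_mul (loc_frac 1 s) (loc_map W (val s)) = loc_map W 1).
by rewrite loc_mulE; apply: loc_frac_eq; rewrite val_mult_set_mul val_mult_set_one; ring.
Qed.

(** The fractions whose numerator is multiplied into [J] by some element of [W] form an ideal
    containing the image of [J]; conversely, [s] becomes a unit. *)
Lemma loc_map_span (W : mult_set R) (J : set R) x : is_ideal J ->
  ideal_span (loc_map W @` J) (loc_map W x) <-> exists2 s, (W : set R) s & J (s * x).
Proof.
move=> hJ; split=> [|[s Ws sx]]; last first.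
  pose t : set_type W := SigSub (mem_set Ws).
  have -> : loc_map W x = loc_frac 1 t * loc_map W (s * x).
    by rewrite rmorphM mulrA (loc_map_unit t) mul1r.
  by apply: (is_idealM _ (is_ideal_span _)); apply: sub_ideal_span; exists (s * x).
pose T := [set z : localization W | exists a s, z = loc_frac a s /\
  exists2 u, (W : set R) u & J (u * a)].
have hT : ideal_span (loc_map W @` J) `<=` T.
  apply: ideal_span_min => [|_ [y Jy <-]]; last first.
    exists y, (mult_set_one W); split=> //; exists 1; first exact: mult_carrier1.
    by rewrite mul1r.
  split.
  - exists 0, (mult_set_one W); split=> //; exists 1; first exact: mult_carrier1.
    by rewrite mulr0; exact: is_ideal0.
  - move=> _ _ [a [s [-> [u Wu ua]]]] [b [t [-> [v Wv vb]]]].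
    exists (a * val t + b * val s), (mult_set_mul s t); split; first exact: loc_addE.
    exists (u * v); first exact: mult_carrierM.
    have -> : u * v * (a * val t + b * val s) =
      (v * val t) * (u * a) + (u * val s) * (v * b) by ring.
    by apply: is_idealD => //; exact: is_idealM.
  - move=> c _ [a [s [-> [u Wu ua]]]]; have [b [t ->]] := loc_fracP c.
    exists (b * a), (mult_set_mul t s); split; first exact: loc_mulE.
    by exists u => //; rewrite mulrCA; exact: is_idealM.
move=> /hT[a [s [/loc_frac_eqP[u Wu e] [v Wv va]]]].
exists (v * u * val s).
  by apply: mult_carrierM; [exact: mult_carrierM|exact: (set_mem (valP s))].
have -> : v * u * val s * x = v * (u * (x * val s)) by ring.
rewrite e; rewrite /= mulr1 mulrCA; exact: is_idealM.
Qed.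

Lemma symbolic_powerE n x : symbolic_power I n x <->
  forall P, Min I P -> exists2 s, ~ (P : set R) s & ideal_pow I n (s * x).
Proof.
split=> h P MP.
  by have /(loc_map_span _ _ (is_ideal_pow I n)) := h P MP.
by apply/(loc_map_span _ _ (is_ideal_pow I n)); exact: h.
Qed.

End SymbolicPower.

(** * Descent of symbolic powers to the polynomial ring *)

Section Presentation.
Variables (k : fieldType) (d : nat) (R : comPzRingType).
Variable phi : {rmorphism mvpoly k d -> R}.
(** This encodes that [R] is a localization of the image of [phi] without naming a multiplicative
    set; [u] inverts the denominator. *)
Hypothesis phi_frac : forall x : R, exists w c, exists2 u, u * phi w = 1 & phi w * x = phi c.

Lemma preimage_is_prime (P : prime_ideal R) : is_prime_ideal [set f | (P : set R) (phi f)].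
Proof.
case: (prime_setP P) => hP P1 PM; split; first exact: is_ideal_preimage.
  by rewrite /= rmorph1.
by move=> x y /=; rewrite rmorphM; exact: PM.
Qed.

Definition prime_preimage P := PrimeIdeal (preimage_is_prime P).

Section Ideal.
Variables (I : set R) (g a : seq (mvpoly k d)).
Hypothesis hI : is_ideal I.
Hypothesis hg : [set f | I (phi f)] = ideal_span [set` g].
Hypothesis ha : [set f | phi f = 0] = ideal_span [set` a].

Local Notation Q := (pow_add g (ideal_span [set` a])).

Lemma phi_pow n f : ideal_pow (ideal_span [set` g]) n f -> ideal_pow I n (phi f).
Proof.
elim: n f => [|n IH] f //=.
have hI' := is_ideal_preimage phi (is_ideal_pow I n.+1).
move: f; change (ideal_pow (ideal_span [set` g]) n.+1 `<=` [set f | ideal_pow I n.+1 (phi f)]).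
apply: ideal_span_min => // _ [x + [y hy <-]]; rewrite -hg /= => Ix.
by rewrite rmorphM; apply: sub_ideal_span; exists (phi x) => //; exists (phi y) => //; exact: IH.
Qed.

(** The denominators of factors and summands multiply to a common one, still invertible in [R]. *)
Lemma pow_frac n x : ideal_pow I n x -> exists w f, [/\ exists u, u * phi w = 1,
  ideal_pow (ideal_span [set` g]) n f & phi w * x = phi f].
Proof.
elim: n x => [|n IH] x.
  by move=> _; have [w [c [u uw wx]]] := phi_frac x; exists w, c; split=> //; exists u.
pose J := [set x | exists w f, [/\ exists u, u * phi w = 1,
  ideal_pow (ideal_span [set` g]) n.+1 f & phi w * x = phi f]].
have hG := is_ideal_pow (ideal_span [set` g]) n.+1.
move: x; change (ideal_pow I n.+1 `<=` J); apply: ideal_span_min.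
  split.
  - exists 1, 0; split; first by exists 1; rewrite rmorph1 mulr1.
      exact: (is_ideal0 hG).
    by rewrite mulr0 rmorph0.
  - move=> x y [w [f [[u uw] Gf wx]]] [v [h [[u' uv] Gh vy]]].
    exists (w * v), (v * f + w * h); split.
    + exists (u * u'); rewrite rmorphM.
      by transitivity ((u * phi w) * (u' * phi v)); [ring|rewrite uw uv mulr1].
    + by apply: (is_idealD hG); exact: (is_idealM _ hG).
    + rewrite rmorphD !rmorphM -wx -vy; ring.
  - move=> c x [w [f [[u uw] Gf wx]]]; have [v [b [u' uv vc]]] := phi_frac c.
    exists (v * w), (b * f); split.
    + exists (u * u'); rewrite rmorphM.
      by transitivity ((u * phi w) * (u' * phi v)); [ring|rewrite uw uv mulr1].
    + exact: (is_idealM _ hG).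
    + rewrite !rmorphM -wx -vc; ring.
move=> _ [x Ix [y /IH[w [f [[u uw] Gf wy]]] <-]].
have [v [b [u' uv vx]]] := phi_frac x.
exists (v * w), (b * f); split.
- exists (u * u'); rewrite rmorphM.
  by transitivity ((u * phi w) * (u' * phi v)); [ring|rewrite uw uv mulr1].
- apply: sub_ideal_span; exists b; last by exists f.
  by rewrite -hg /= -vx; exact: is_idealM.
- rewrite !rmorphM -wy -vx; ring.
Qed.

Lemma pow_add_phi n f : Q n f -> ideal_pow I n (phi f).
Proof.
move=> [x Gx [y + <-]]; rewrite -ha /= => y0.
by rewrite rmorphD y0 addr0; exact: phi_pow.
Qed.

Lemma phi_pow_add n f : ideal_pow I n (phi f) ->
  exists2 w, (exists u, u * phi w = 1) & Q n (w * f).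
Proof.
move=> /pow_frac[w [h [uw Gh e]]]; exists w => //; exists h => //.
exists (w * f - h); last by rewrite addrC subrK.
by rewrite -ha /= rmorphB rmorphM e subrr.
Qed.

(** The denominators introduced map to units of [R] and so avoid the preimage of every prime:
    witnesses outside [P] pass between [R] and the polynomial ring. *)
Lemma symbolic_power_phi n f : symbolic_power I n (phi f) <->
  forall P, (prime_preimage @` Min I) P -> exists2 x, ~ (P : set (mvpoly k d)) x & Q n (x * f).
Proof.
have unitP (P : prime_ideal R) u v s : u * v = 1 -> (P : set R) (v * s) -> (P : set R) s.
  move=> uv h; rewrite -[s]mul1r -uv -mulrA.
  by case: (prime_setP P) => [[_ _ M] _ _]; exact: M.
split=> [/symbolic_powerE h _ [P MP <-]|h].
  have [s Ps sf] := h P MP; have [w [b [u uw ws]]] := phi_frac s.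
  have /phi_pow_add[v [u' uv] Qv] : ideal_pow I n (phi (b * f)).
    by rewrite rmorphM -ws -mulrA; apply: is_idealM => //; exact: is_ideal_pow.
  exists (v * b); last by rewrite -mulrA.
  by rewrite /= rmorphM => /(unitP _ _ _ _ uv); rewrite -ws => /(unitP _ _ _ _ uw).
apply/symbolic_powerE => P MP.
have [|x Px Qx] := h (prime_preimage P); first by exists P.
by exists (phi x) => //; rewrite -rmorphM; exact: pow_add_phi.
Qed.

(** Each [x] in the symbolic power is a unit times some [phi c], and this [c] lies in the
    contraction generated by [s]. *)
Lemma symbolic_power_gens n s :
  [set f | forall P, (prime_preimage @` Min I) P ->
     exists2 x, ~ (P : set (mvpoly k d)) x & Q n (x * f)] = ideal_span [set` s] ->
  symbolic_power I n = ideal_span [set` map phi s].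
Proof.
move=> e; have sp f : ideal_span [set` s] f <-> symbolic_power I n (phi f).
  by rewrite -e; symmetry; exact: symbolic_power_phi.
apply/seteqP; split=> [x hx|].
  have [w [c [u uw wx]]] := phi_frac x.
  have -> : x = u * phi c by rewrite -wx mulrA uw mul1r.
  apply: (is_idealM _ (is_ideal_span _)).
  have : ideal_span [set` s] c.
    by apply/sp; rewrite -wx; exact: (is_idealM _ (@is_ideal_symbolic_power R I n)).
  move: c {wx}.
  change (ideal_span [set` s] `<=` [set c | ideal_span [set` map phi s] (phi c)]).
  apply: ideal_span_min; first exact: is_ideal_preimage (is_ideal_span _).
  by move=> c cs; apply: sub_ideal_span; exact: map_f.
apply: ideal_span_min; first exact: is_ideal_symbolic_power.
by move=> _ /mapP[c cs ->]; apply/sp; exact: sub_ideal_span.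
Qed.

End Ideal.

Lemma symbolic_power_bound (I : set R) : is_ideal I -> exists B e, forall n,
  exists2 s : seq R, (size s <= B * n.+1 ^ e)%N &
    symbolic_power I n = ideal_span [set` s].
Proof.
move=> hI.
have noe : noetherian (mvpoly k d).
  by apply: noetherian_mvpoly; exact: noetherian_field.
have [g hg] := noetherian_ideal noe (is_ideal_preimage phi hI).
have h0 : is_ideal [set f | phi f = 0].
  split=> [|x y|c x] /=; first exact: rmorph0.
    by move=> ex ey; rewrite rmorphD ex ey addr0.
  by move=> ex; rewrite rmorphM ex mulr0.
have [a ha] := noetherian_ideal noe h0.
have [B [e hBe]] := saturation_bound g a (prime_preimage @` Min I).
exists B, e => n; have [s sB es] := hBe n.
exists (map phi s); first by rewrite size_map.
exact: symbolic_power_gens es.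
Qed.

End Presentation.

Lemma fin_gen_algebra_mvpoly (k : fieldType) (A : comPzRingType)
    (iota : {rmorphism k -> A}) : fin_gen_algebra iota -> (1 : A) <> 0 ->
  exists d (phi : {rmorphism mvpoly k d -> A}), forall x, exists f, phi f = x.
Proof.
move=> [g hg] A1.
have A1' : (1 : A) != 0 by exact/eqP.
(* [A'] is [A] with the structure of a nonzero ring, the target that [mvpoly_eval] asks for. *)
pose A' : comNzRingType := HB.pack (GRing.ComPzRing.sort A) (GRing.PzSemiRing_isNonZero.Build A A1').
have [phi [phiC phiX _]] := @mvpoly_eval k A' iota (fun i => g`_i) (size g).
exists (size g), phi => x.
suff : x \in [pred x | `[< exists f, phi f = x >]] by move=> /asboolP.
apply: hg => [|c|y /(nthP 0)[i ig <-]].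
- split.
  + by apply/asboolP; exists 1; rewrite rmorph1.
  + by move=> y z /asboolP[f <-] /asboolP[h <-]; apply/asboolP; exists (f - h); rewrite rmorphB.
  + by move=> y z /asboolP[f <-] /asboolP[h <-]; apply/asboolP; exists (f * h); rewrite rmorphM.
- by apply/asboolP; exact: phiC.
- by apply/asboolP; exact: phiX.
Qed.

Lemma ess_finite_type_fractions (k : fieldType) (R : comPzRingType) :
  ess_finite_type k R -> (1 : R) <> 0 ->
  exists d (phi : {rmorphism mvpoly k d -> R}),
    forall x : R, exists w c, exists2 u, u * phi w = 1 & phi w * x = phi c.
Proof.
move=> [A [iota [W [hA [f [f' ff' f'f]]]]]] R1.
have A1 : (1 : A) <> 0.
  move=> e; apply: R1; rewrite -(rmorph1 f) -(rmorph1 (loc_map W)) e.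
  by rewrite !rmorph0.
have [d [phi phi_surj]] := fin_gen_algebra_mvpoly hA A1.
exists d, (f \o loc_map W \o phi) => x.
have [a [s e]] := loc_fracP (f' x).
have [w ew] := phi_surj (val s); have [c ec] := phi_surj a.
exists w, c; exists (f (loc_frac 1 s)); rewrite /= ew.
  by rewrite -rmorphM -(rmorph1 f); congr (f _); exact: loc_map_unit.
rewrite ec -(f'f x) e -rmorphM; congr (f _).
have -> : loc_frac a s = loc_map W a * loc_frac 1 s.
  change (loc_frac a s = loc_mul (loc_map W a) (loc_frac 1 s)).
  by rewrite loc_mulE; apply: loc_frac_eq; rewrite val_mult_set_mul val_mult_set_one; ring.
transitivity (loc_map W a * (loc_frac 1 s * loc_map W (val s))); first by ring.
by rewrite loc_map_unit mulr1.
Qed.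

Lemma symbolic_power_poly (k : fieldType) (R : comPzRingType) (I : set R) :
  ess_finite_type k R -> is_ideal I -> exists B e, forall n,
  exists2 s : seq R, (size s <= B * n.+1 ^ e)%N &
    symbolic_power I n = ideal_span [set` s].
Proof.
move=> hR hI; have [R1|R1] := pselect ((1 : R) = 0); last first.
  have [d [phi hphi]] := ess_finite_type_fractions hR R1.
  exact: symbolic_power_bound hphi I hI.
(* In the zero ring the empty list generates every ideal. *)
have R0 (x : R) : x = 0 by rewrite -[x]mul1r R1 mul0r.
exists 0%N, 0%N => n; exists [::] => //; apply/seteqP.
by split=> x _; rewrite (R0 x); apply: is_ideal0;
  [exact: is_ideal_span|exact: is_ideal_symbolic_power].
Qed.

Lemma mu_ideal_span_seq (K : realType) (R : comPzRingType) (s : seq R) :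
  (mu K (ideal_span [set` s]) <= (size s)%:R%:E)%E.
Proof.
apply: (@le_trans _ _ (#|` [fset x in s]%fset|%:R)%:E).
  apply: ereal_inf_lbound; exists [fset x in s]%fset => //=.
  by congr ideal_span; apply/seteqP; split=> x /=; rewrite !inE.
by rewrite lee_fin ler_nat card_fseq size_undup.
Qed.

Theorem theorem1 (K : realType) (k : fieldType) (R : comPzRingType)
    (hR : ess_finite_type k R) (I : set R) (hI : is_ideal I) :
  (symbolic_analytic_spread K I < +oo)%E /\
  exists t : K,
    is_bigO_pow (fun n => mu K (symbolic_power I n)) (t - 1)%R.
Proof.
have [t ht] : exists t : K,
    is_bigO_pow (fun n => mu K (symbolic_power I n)) (t - 1)%R.
  have [B [e hBe]] := symbolic_power_poly hR hI.
  (* This [t] makes [t - 1] the exponent [e]; the factor [2 ^ e] comes from [n.+1 <= 2 * n] for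
     [n > 0]. *)
  exists (e%:R + 1); rewrite addrK; exists (B * 2 ^ e)%:R.
  near=> n; have [s sB ->] := hBe n.
  apply: (le_trans (mu_ideal_span_seq K s)).
  rewrite lee_fin powR_mulrn // -natrX -natrM ler_nat (leq_trans sB) //.
  have n1 : (0 < n)%N by near: n; exact: nbhs_infty_gt.
  rewrite -mulnA leq_mul2l -expnMn; apply/orP; right.
  by case: (e) => // m; rewrite leq_exp2r //; lia.
split; last by exists t.
apply: (@le_lt_trans _ _ t%:E); last exact: ltry.
by apply: ereal_inf_lbound; exists t.
Unshelve. all: by end_near.
Qed.
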